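(* Let $1/2<\alpha\le 1$ and $1/2<\gamma\le 1$. Let $Y_i=f_0(x_i)+\varepsilon_i$, $1\le i\le n$, with $\varepsilon_i$ i.i.d. $\mathcal N(0,1)$ and fixed design points $x_i=i/n\in[0,1]$, where $f_0\in\mathcal H^\alpha_1$. Let $a\in\mathcal H^\gamma_1$ with $\|a\|_\infty<C_a$ for some constant $C_a$, and let $\Psi(f)=\frac1n\sum_{i=1}^n a(x_i)f(x_i)$. Let $K=K_n=\lfloor (n/\log n)^{1/(2\alpha+1)}\rfloor$, let $\{\Omega_k\}_{k=1}^K$ be the equivalent blocks partition of $[0,1]$ into $K$ intervals, and let $\mathcal F[K]$ be the set of step functions $f^K(x)=\sum_{k=1}^K \mathbb I(x\in\Omega_k)\beta_k$ with $\beta=(\beta_1,\dots,\beta_K)'\in\mathbb R^K$. Put on $\mathcal F[K]$ the prior induced by $\beta\sim\mathcal N_K(0,\Sigma)$, where $\Sigma$ is a $K\times K$ positive definite matrix with $\lambda_{\min}(\Sigma)>c>0$ and $\lambda_{\max}(\Sigma)\lesssim n$. Then $$\Pi\left(\sqrt n\,(\Psi(f^K)-\widehat\Psi_K)\mid Y^{(n)}\right)\rightsquigarrow\mathcal N(0,\|a\|_L^2)$$ in $\mathbb P_0^n$-probability as $n\to\infty$, where $\widehat\Psi_K=\Psi(f_0^K)+W_n(a^K)/\sqrt n$.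
   Context: $\mathcal H^\alpha_p$ is the set of $\alpha$-Hölder continuous functions ($0<\alpha\le1$) on $[0,1]^p$. $Y^{(n)}=(Y_1,\dots,Y_n)'$ and $\mathbb P_0^n$ is its law under $f_0$. $\Pi(\cdot\mid Y^{(n)})$ is the posterior distribution given $Y^{(n)}$, computed with the Gaussian likelihood of the model $Y_i=f(x_i)+\varepsilon_i$. Equivalent blocks partition: intervals $\Omega_1,\dots,\Omega_K$ partitioning $[0,1]$ with roughly equal numbers of design points, i.e. $\mu(\Omega_k):=\frac1n\sum_{i=1}^n\mathbb I(x_i\in\Omega_k)\asymp 1/K$ (and, the design being a regular grid, roughly equal lengths), with constants uniform in $k$ and $n$. $\langle f,g\rangle_L=\frac1n\sum_{i=1}^n f(x_i)g(x_i)$ and $\|f\|_L^2=\frac1n\sum_{i=1}^n f(x_i)^2$. For a function $g$, $W_n(g)=\frac1n\sum_{i=1}^n\sqrt n\,\varepsilon_i\,g(x_i)$. $a^K$ and $f_0^K$ are the $\|\cdot\|_L$-projections of $a$ and $f_0$ onto $\mathcal F[K]$, i.e. on each $\Omega_k$ they equal the average of $a$ (respectively $f_0$) over the design points in $\Omega_k$. $\lesssim$ denotes inequality up to a constant not depending on $n$, $a\asymp b$ means $a\lesssim b$ and $b\lesssim a$, and $c$ does not depend on $n$. $\lambda_{\min},\lambda_{\max}$ are extremal eigenvalues. The convergence $\rightsquigarrow$ in $\mathbb P_0^n$-probability means: if $d_{BL}$ denotes the bounded Lipschitz metric for weak convergence of probability measures on $\mathbb R$, then the $d_{BL}$-distance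 between the (random) posterior law of $\sqrt n\,(\Psi(f^K)-\widehat\Psi_K)$ and $\mathcal N(0,\|a\|_L^2)$ tends to $0$ in $\mathbb P_0^n$-probability. *)

(* Defs.v *)
From HB Require Import structures.
From mathcomp Require Import all_boot all_order all_algebra.
From mathcomp Require Import all_classical all_reals all_analysis.
From mathcomp Require Import measurable_realfun.
Import numFieldNormedType.Exports.
Import Order.TTheory GRing.Theory Num.Theory.

Set Implicit Arguments.
Unset Strict Implicit.
Unset Printing Implicit Defensive.

Local Open Scope classical_set_scope.
Local Open Scope ring_scope.

Section Regression.
Context {R : realType}.

(* Only the values of a function on [0, 1] matter below. *)
Definition holder01 (s : R) (f : R -> R) : Prop :=
  exists L : R, forall x y : R, x \in `[0, 1] -> y \in `[0, 1] ->
    `|f x - f y| <= L * `|x - y| `^ s.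

Definition supnorm01 (f : R -> R) : R := sup [set `|f x| | x in `[0, 1]].

(* Zero-based indexing: i : 'I_n stands for the (i+1)-th design point. *)
Definition design (n : nat) (i : 'I_n) : R := i.+1%:R / n%:R.

Definition innerL (n : nat) (f g : R -> R) : R :=
  n%:R^-1 * \sum_(i < n) f (design i) * g (design i).

Definition sqnormL (n : nat) (f : R -> R) : R :=
  n%:R^-1 * \sum_(i < n) f (design i) ^+ 2.

Definition block_mass (n : nat) (I : interval R) : R :=
  n%:R^-1 * \sum_(i < n) (design i \in I)%:R.

Definition step (K : nat) (Om : 'I_K -> interval R) (b : 'I_K -> R) (x : R) : R :=
  \sum_(k < K) (x \in Om k)%:R * b k.

Definition block_mean (n : nat) (I : interval R) (g : R -> R) : R :=
  (\sum_(i < n | design i \in I) g (design i)) / #|[pred i : 'I_n | design i \in I]|%:R.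

Definition projK (n K : nat) (Om : 'I_K -> interval R) (g : R -> R) : R -> R :=
  step Om (fun k => block_mean n (Om k) g).

Definition nblocks (alpha : R) (n : nat) : nat :=
  Num.truncn ((n%:R / ln n%:R) `^ (2 * alpha + 1)^-1).

(* Stated for n >= 2, where ln n > 0 and there is at least one block. *)
Definition equivalent_blocks (K : nat -> nat)
    (Om : forall n, 'I_(K n) -> interval R) : Prop :=
  exists c1 c2 : R, 0 < c1 /\ forall n, (1 < n)%N ->
    partition [set: 'I_(K n)] (fun k => [set` Om n k]) `[0, 1] /\
    forall k : 'I_(K n),
      (c1 / (K n)%:R <= block_mass n (Om n k) <= c2 / (K n)%:R) /\
      ((c1 / (K n)%:R)%:E <= lebesgue_measure [set` Om n k] <= (c2 / (K n)%:R)%:E)%E.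

Definition posdefmx (K : nat) (S : 'M[R]_K) : Prop :=
  S^T = S /\ forall u : 'cV[R]_K, u != 0 -> 0 < (u^T *m S *m u) ord0 ord0.

Definition lambda_min (K : nat) (S : 'M[R]_K) : R := inf [set l | eigenvalue S l].
Definition lambda_max (K : nat) (S : 'M[R]_K) : R := sup [set l | eigenvalue S l].

(* Lebesgue measure on R^K, as an iterated product. *)
Fixpoint lebesgue_tuple (K : nat) : set (K.-tuple R) -> \bar R :=
  match K with
  | 0 => dirac [tuple]
  | K'.+1 => pushforward (lebesgue_measure \x @lebesgue_tuple K')%E
               (fun p : R * K'.-tuple R => [tuple of p.1 :: p.2])
  end.

Let lebesgue_tuple_measure K :
  {m : {sigma_finite_measure set (K.-tuple R) -> \bar R} | @lebesgue_tuple K = m}.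
Proof.
elim: K => [|K [m mE]]; first by exists (dirac [tuple]).
pose c (p : measurableTypeR R * K.-tuple R) : K.+1.-tuple R :=
  [tuple of (p.1 : R) :: p.2].
have mc : measurable_fun setT c by apply: measurable_cons.
pose p : {measure set _ -> \bar R} :=
  (@lebesgue_measure R \x m)%E.
have [q qE] : {q : set (K.+1.-tuple R) -> \bar R | q = pushforward p c} by eexists.
have q0 : q set0 = 0%E by rewrite qE /pushforward preimage_set0 measure0.
have qge0 A : (0 <= q A)%E by rewrite qE; exact: measure_ge0.
have qadd : semi_sigma_additive q.
  move=> F mF tF mUF; rewrite qE /pushforward preimage_bigcup.
  apply: measure_semi_sigma_additive.
  - by move=> n; rewrite -[X in measurable X]setTI; exact: mc.
  - apply/trivIsetP => /= i j _ _ ij; rewrite -preimage_setI.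
    by move/trivIsetP : tF => -> //; rewrite preimage_set0.
  - by rewrite -preimage_bigcup -[X in measurable X]setTI; exact: mc.
pose qm : {measure set (K.+1.-tuple R) -> \bar R} :=
  HB.pack q (isMeasure.Build _ _ _ q q0 qge0 qadd).
have qfin : sigma_finite setT qm.
  have /sigma_finiteP[F [TF ndF Foo]] := sigma_finiteT (@lebesgue_measure R).
  have /sigma_finiteP[G [TG ndG Goo]] := sigma_finiteT m.
  pose g (t : K.+1.-tuple R) := (thead t : measurableTypeR R, [tuple of behead t]).
  have mg : measurable_fun setT g.
    apply/measurable_fun_pair => /=; first exact: measurable_tnth.
    exact: measurable_behead.
  exists (fun i => g @^-1` (F i `*` G i)).
    apply/esym; rewrite -preimage_bigcup -subTset => t _ /=.
    have [i _ Fi] : (\bigcup_i F i) (thead t) by rewrite -TF.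
    have [j _ Gj] : (\bigcup_i G i) [tuple of behead t] by rewrite -TG.
    exists (maxn i j) => //; split => /=.
    - by move: Fi; exact/subsetPset/ndF/leq_maxl.
    - by move: Gj; exact/subsetPset/ndG/leq_maxr.
  move=> i; have [mF Fi] := Foo i; have [mG Gi] := Goo i.
  split; first by rewrite -[X in measurable X]setTI; apply: mg => //; exact: measurableX.
  rewrite /qm/= qE /pushforward -comp_preimage (_ : g \o c = id); last first.
    by apply/funext => -[x t]; rewrite /g /c /= theadE; congr (_, _); exact: val_inj.
  rewrite preimage_id [ltLHS](product_measure1E lebesgue_measure m mF mG).
  by rewrite lte_mul_pinfty// ge0_fin_numE.
pose r : {sigma_finite_measure set (K.+1.-tuple R) -> \bar R} :=
  HB.pack q qm (Measure_isSigmaFinite.Build _ _ _ qm qfin).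
exists r.
by rewrite /= qE mE.
Qed.

Let lebesgue_tuple0 K : @lebesgue_tuple K set0 = 0%E.
Proof. by have [m ->] := lebesgue_tuple_measure K; exact: measure0. Qed.

Let lebesgue_tuple_ge0 K A : (0 <= @lebesgue_tuple K A)%E.
Proof. by have [m ->] := lebesgue_tuple_measure K; exact: measure_ge0. Qed.

Let lebesgue_tuple_additive K : semi_sigma_additive (@lebesgue_tuple K).
Proof.
by have [m ->] := lebesgue_tuple_measure K; exact: measure_semi_sigma_additive.
Qed.

HB.instance Definition _ K := isMeasure.Build _ _ _ (@lebesgue_tuple K)
  (lebesgue_tuple0 K) (@lebesgue_tuple_ge0 K) (@lebesgue_tuple_additive K).

Let lebesgue_tuple_sigma_finite K : sigma_finite setT (@lebesgue_tuple K).
Proof. by have [m ->] := lebesgue_tuple_measure K; exact: sigma_finiteT. Qed.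

HB.instance Definition _ K := Measure_isSigmaFinite.Build _ _ _
  (@lebesgue_tuple K) (lebesgue_tuple_sigma_finite K).

(* Density of N_K(0, S), for S positive definite. *)
Definition multinormal_pdf (K : nat) (S : 'M[R]_K) (b : K.-tuple R) : R :=
  let u := \col_(k < K) tnth b k in
  (Num.sqrt ((2 * pi) ^+ K * \det S))^-1 *
  expR (- ((u^T *m invmx S *m u) ord0 ord0 / 2)).

Lemma multinormal_pdf_ge0 K (S : 'M[R]_K) b : 0 <= multinormal_pdf S b.
Proof. by rewrite mulr_ge0 ?expR_ge0// invr_ge0 sqrtr_ge0. Qed.

Lemma measurable_multinormal_pdf K (S : 'M[R]_K) :
  measurable_fun setT (multinormal_pdf S).
Proof.
apply: measurable_funM => //; apply: measurableT_comp => //.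
apply: measurableT_comp => //; apply: measurable_funM => //.
under eq_fun do rewrite mxE.
apply: measurable_sum => k; apply: measurable_funM; last first.
  by under eq_fun do rewrite mxE; exact: measurable_tnth.
under eq_fun do rewrite mxE.
apply: measurable_sum => l; apply: measurable_funM => //.
by under eq_fun do rewrite !mxE; exact: measurable_tnth.
Qed.

Definition multinormal (K : nat) (S : 'M[R]_K) : set (K.-tuple R) -> \bar R :=
  fun B => (\int[@lebesgue_tuple K]_(b in B) (multinormal_pdf S b)%:E)%E.

Let multinormal0 K (S : 'M[R]_K) : multinormal S set0 = 0%E.
Proof. by rewrite /multinormal integral_set0. Qed.

Let multinormal_ge0 K (S : 'M[R]_K) B : (0 <= multinormal S B)%E.
Proof. by apply: integral_ge0 => b _; rewrite lee_fin multinormal_pdf_ge0. Qed.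

Let multinormal_additive K (S : 'M[R]_K) : semi_sigma_additive (multinormal S).
Proof.
move=> F mF tF mUF; rewrite /multinormal ge0_integral_bigcup//=.
- apply: is_cvg_ereal_nneg_natsum_cond => n _ _.
  by apply: integral_ge0 => b _; rewrite lee_fin multinormal_pdf_ge0.
- apply/measurable_funTS/measurable_EFinP; exact: measurable_multinormal_pdf.
- by move=> b _; rewrite lee_fin multinormal_pdf_ge0.
Qed.

HB.instance Definition _ K (S : 'M[R]_K) := isMeasure.Build _ _ _ (multinormal S)
  (multinormal0 S) (@multinormal_ge0 K S) (@multinormal_additive K S).

Definition likelihood (n K : nat) (Om : 'I_K -> interval R) (y : 'I_n -> R)
    (b : K.-tuple R) : R :=
  \prod_(i < n) normal_pdf (step Om (tnth b) (design i)) 1 (y i).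

Lemma likelihood_ge0 n K (Om : 'I_K -> interval R) (y : 'I_n -> R) b :
  0 <= likelihood Om y b.
Proof. by apply: prodr_ge0 => i _; exact: normal_pdf_ge0. Qed.

Lemma measurable_step K (Om : 'I_K -> interval R) (x : R) :
  measurable_fun setT (fun b : K.-tuple R => step Om (tnth b) x).
Proof.
apply: measurable_sum => k; apply: measurable_funM => //; exact: measurable_tnth.
Qed.

Lemma measurable_likelihood n K (Om : 'I_K -> interval R) (y : 'I_n -> R) :
  measurable_fun setT (likelihood Om y).
Proof.
apply: measurable_prod => i _.
rewrite (_ : (fun b => _) =
    normal_pdf (y i) 1 \o (fun b => step Om (tnth b) (design i))).
  by apply: measurableT_comp; [exact: measurable_normal_pdf|exact: measurable_step].
apply/funext => b /=; rewrite /normal_pdf oner_eq0 /normal_fun.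
by rewrite -(sqrrN (y i - _)) opprB.
Qed.

(* The joint measure B |-> \int_B likelihood(y | b) dN_K(0, S)(b), whose
   normalization is the posterior. *)
Definition joint (n K : nat) (Om : 'I_K -> interval R) (S : 'M[R]_K)
    (y : 'I_n -> R) : set (K.-tuple R) -> \bar R :=
  fun B => (\int[multinormal S]_(b in B) (likelihood Om y b)%:E)%E.

Let joint0 n K (Om : 'I_K -> interval R) S (y : 'I_n -> R) :
  joint Om S y set0 = 0%E.
Proof. by rewrite /joint integral_set0. Qed.

Let joint_ge0 n K (Om : 'I_K -> interval R) S (y : 'I_n -> R) B :
  (0 <= joint Om S y B)%E.
Proof. by apply: integral_ge0 => b _; rewrite lee_fin likelihood_ge0. Qed.

Let joint_additive n K (Om : 'I_K -> interval R) S (y : 'I_n -> R) :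
  semi_sigma_additive (joint Om S y).
Proof.
move=> F mF tF mUF; rewrite /joint ge0_integral_bigcup//=.
- apply: is_cvg_ereal_nneg_natsum_cond => m _ _.
  by apply: integral_ge0 => b _; rewrite lee_fin likelihood_ge0.
- apply/measurable_funTS/measurable_EFinP; exact: measurable_likelihood.
- by move=> b _; rewrite lee_fin likelihood_ge0.
Qed.

HB.instance Definition _ n K (Om : 'I_K -> interval R) S (y : 'I_n -> R) :=
  isMeasure.Build _ _ _ (joint Om S y)
    (joint0 Om S y) (joint_ge0 Om S y) (@joint_additive n K Om S y).

(* Posterior law of the step heights (Bayes' formula). The second argument of
   mnormalize is a default for null or infinite evidence; the evidence is
   positive and finite when S is positive definite. *)
Definition posterior (n K : nat) (Om : 'I_K -> interval R) (S : 'M[R]_K)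
    (y : 'I_n -> R) : probability (K.-tuple R) R :=
  mnormalize (joint Om S y) (dirac (nseq_tuple K (0 : R))).

(* b |-> sqrt n (Psi(f^K) - c), where f^K has step heights b. *)
Definition scaled_error (n K : nat) (a : R -> R) (Om : 'I_K -> interval R) (c : R)
    (b : K.-tuple R) : measurableTypeR R :=
  (Num.sqrt n%:R * (innerL n a (step Om (tnth b)) - c))%R.

Let measurable_scaled_error n K a (Om : 'I_K -> interval R) c :
  measurable_fun setT (scaled_error n a Om c).
Proof.
apply: measurable_funM => //; apply: measurable_funB => //.
apply: measurable_funM => //; apply: measurable_sum => i.
by apply: measurable_funM => //; exact: measurable_step.
Qed.

HB.instance Definition _ n K a (Om : 'I_K -> interval R) c :=
  isMeasurableFun.Build _ _ _ (measurableTypeR R) (scaled_error n a Om c)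
    (@measurable_scaled_error n K a Om c).

Definition posterior_error_law (n K : nat) (a : R -> R) (Om : 'I_K -> interval R)
    (S : 'M[R]_K) (y : 'I_n -> R) (c : R) : probability (measurableTypeR R) R :=
  distribution (posterior Om S y)
    (scaled_error n a Om c : {mfun K.-tuple R >-> measurableTypeR R}).

(* N(0, v); the degenerate case is separate because the library's
   normal_prob m 0 is the uniform law on [0, 1]. *)
Definition centered_normal (v : R) : probability (measurableTypeR R) R :=
  if v == 0 then (dirac (0 : measurableTypeR R) : probability _ _)
  else (normal_prob 0 (Num.sqrt v) : probability _ _).

Definition dBL (mu nu : probability (measurableTypeR R) R) : R :=
  sup [set `|(\int[mu]_x h x) - (\int[nu]_x h x)| | h in
        [set h : R -> R | (forall x, `|h x| <= 1) /\
                          (forall x y, `|h x - h y| <= `|x - y|)]].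

Definition noise_avg (n : nat) (e : 'I_n -> R) (g : R -> R) : R :=
  n%:R^-1 * \sum_(i < n) Num.sqrt n%:R * e i * g (design i).

Definition psi_hat (n K : nat) (a f0 : R -> R) (Om : 'I_K -> interval R)
    (e : 'I_n -> R) : R :=
  innerL n a (projK n Om f0) + noise_avg e (projK n Om a) / Num.sqrt n%:R.

Definition mutually_independent d (T : measurableType d) (P : probability T R)
    (n : nat) (X : 'I_n -> T -> R) : Prop :=
  forall (J : {set 'I_n}) (B : 'I_n -> set R), (forall i, measurable (B i)) ->
    P (\bigcap_(i in [set` J]) X i @^-1` B i) =
    (\prod_(i in J) P (X i @^-1` B i))%E.

Definition iid_std_normal d (T : measurableType d) (P : probability T R)
    (n : nat) (X : 'I_n -> {RV P >-> R}) : Prop :=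
  mutually_independent P X /\
  forall i (B : set R), measurable B -> distribution P (X i) B = normal_prob 0 1 B.

End Regression.

(* Main.v *)
From HB Require Import structures.
Require Import Defs.
From mathcomp Require Import all_boot all_order all_algebra.
From mathcomp Require Import all_classical all_reals all_analysis.
From mathcomp Require Import measurable_realfun ring lra.
Import numFieldNormedType.Exports.
Import Order.TTheory GRing.Theory Num.Theory.

Set Implicit Arguments.
Unset Strict Implicit.
Unset Printing Implicit Defensive.

Local Open Scope classical_set_scope.
Local Open Scope ring_scope.

(** The posterior is an explicit Gaussian law. With [N] the diagonal matrix of the
    block sizes, the likelihood times the prior density is, as a function of the step
    heights [b], proportional to [exp (l^T b - b^T Q b / 2)], where [Q = N + Sigma^-1]
    and [l] collects the block sums of the observations. Hence the posterior law of
    the linear functional [sqrt n (Psi (f^K) - PsiHat)] is a normal law whose mean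
    depends on the data and whose variance does not, and the theorem amounts to three
    facts: the mean tends to 0 in probability, the variance tends to that of the limit,
    and the bounded Lipschitz distance of two normal laws is controlled by the
    distances of their means and of their standard deviations.

    The Gaussian integral is computed one coordinate at a time. Completing the square
    in the first step height leaves a Gaussian integral for the Schur complement of
    [Q], and the two independent contributions to the functional are merged by the
    convolution of normal laws ([gaussian_linear_form]). If [Q p = v], then under the
    density above [v^T b] has mean [p^T l] and variance [v^T p]; the normalizing
    constant cancels in Bayes' formula ([posterior_error_lawE]).

    The system [Q p = v] reduces to [(Sigma + N^-1) z = abar], where [abar] is the
    vector of block means of [a]: the functional has [v = N abar / n], whence
    [p = (abar - N^-1 z) / n]. Since [PsiHat] is the sum over the blocks of
    [N_k abar_k ybar_k / n], with [ybar] the block means of the observations, this gives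
      mean     = - z^T ybar / sqrt n,
      variance = (abar^T N abar - z^T abar) / n
    ([posterior_gauss_law]). The least eigenvalue of [Sigma] exceeds [c], so
    [c |z|^2 <= z^T abar <= |abar|^2 / c], and [|abar|^2] is of order [K]. As each
    block holds about [n / K] points, [|ybar|^2] is at most of order [K] times the
    average of the squared observations. Therefore the mean is [O (K / sqrt n)] times
    a variable with bounded expectation ([error_mean_le]), while the variance differs
    from the squared empirical norm of [a] by [O (K / n)] plus the squared oscillation
    of [a] on a block ([error_var_le]). For [alpha > 1/2] the number of blocks tends
    to infinity more slowly than [sqrt n], and Markov's inequality concludes.

    The events in the theorem are measurable because the distance is a Lipschitz
    function of the mean, which is a linear function of the errors. *)

(** * Integration against a measure with a density *)

Section density.
Local Open Scope ereal_scope.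
Context d (T : measurableType d) (R : realType).
Variables (mu nu : {measure set T -> \bar R}) (g : T -> R).
Hypothesis mg : measurable_fun setT g.
Hypothesis g0 : forall x, (0 <= g x)%R.
Hypothesis nuE : forall A, measurable A -> nu A = \int[mu]_(x in A) (g x)%:E.

Import HBNNSimple.

Let integral_density_nnsfun (h : {nnsfun T >-> R}) :
  \int[nu]_x (h x)%:E = \int[mu]_x (h x * g x)%:E.
Proof.
transitivity (\int[nu]_x
   (\sum_(y \in range h) (y * \1_(h @^-1` [set y]) x)%:E)).
  by apply: eq_integral => t _; rewrite /= fimfunE -fsumEFin.
have indich r : measurable_fun setT (fun x => (r * \1_(h @^-1` [set r]) x)%:E).
  exact/measurable_EFinP/measurable_funM.
rewrite ge0_integral_fsum//; last by move=> m y _; exact: nnfun_muleindic_ge0.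
transitivity (\int[mu]_x (\sum_(y \in range h)
    (y * \1_(h @^-1` [set y]) x)%:E * (g x)%:E)).
  rewrite ge0_integral_fsum//; last 2 first.
    - move=> y; apply: emeasurable_funM => //; exact/measurable_EFinP.
    - by move=> m y _; rewrite mule_ge0 ?lee_fin// -lee_fin nnfun_muleindic_ge0.
  apply: eq_fsbigr => r rh.
  under eq_integral do rewrite EFinM.
  rewrite integralZl_indic_nnsfun => //.
  under [RHS]eq_integral do rewrite EFinM -muleA.
  rewrite ge0_integralZl//.
  - under [in RHS]eq_integral do rewrite muleC.
    rewrite [X in _ = _ * X](eq_integral ((EFin \o g) \_ (h @^-1` [set r]))); last first.
      by move=> x xE; rewrite epatch_indic.
    by rewrite -integral_mkcond -nuE// integral_indic// setIT.
  - apply: emeasurable_funM; exact/measurable_EFinP.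
  - by move=> t _; rewrite mule_ge0 ?lee_fin.
  - by move: rh; rewrite inE => -[t _ <-]; rewrite lee_fin.
apply: eq_integral => x _; rewrite EFinM [in RHS]fimfunE -fsumEFin//.
by rewrite ge0_mule_fsuml// => y; exact: nnfun_muleindic_ge0.
Qed.

(** Both sides are monotone limits along simple functions increasing to [f]. *)
Lemma ge0_integral_density (f : T -> \bar R) :
  measurable_fun setT f -> (forall x, 0 <= f x) ->
  \int[nu]_x f x = \int[mu]_x (f x * (g x)%:E).
Proof.
move=> mf f0; pose h := nnsfun_approx measurableT mf.
have fE x : f x = limn (EFin \o h ^~ x).
  by apply/esym/cvg_lim => //; exact: cvg_nnsfun_approx.
transitivity (limn (fun n => \int[nu]_x (h n x)%:E)).
  rewrite -monotone_convergence//.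
  - by apply: eq_integral => x _; rewrite fE.
  - by move=> n; apply/measurable_EFinP.
  - by move=> n x _; rewrite lee_fin.
  - by move=> x _ a b ab; rewrite lee_fin; exact/lefP/nd_nnsfun_approx.
under eq_fun do rewrite integral_density_nnsfun.
rewrite -monotone_convergence//.
- apply: eq_integral => x _; under eq_fun do rewrite EFinM.
  apply/cvg_lim => //; apply: cvgeZr => //; exact: cvg_nnsfun_approx.
- by move=> n; apply/measurable_EFinP/measurable_funM.
- by move=> n x _; rewrite lee_fin mulr_ge0.
- move=> x _ a b ab; rewrite lee_fin ler_wpM2r//; exact/lefP/nd_nnsfun_approx.
Qed.

End density.

(** * Normal laws on the line *)

Section gauss1.
Context {R : realType}.
Local Notation leb := (@lebesgue_measure R).

Definition affine (m s : R) (x : measurableTypeR R) : measurableTypeR R :=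
  (m + s * x)%R.

Lemma measurable_affine (m s : R) : measurable_fun setT (affine m s).
Proof. by apply: measurable_funD => //; apply: measurable_funM. Qed.

(* The uniqueness of Lebesgue measure applies to bundled measures: this packs the
   scaled image of Lebesgue measure under an affine map as one. *)
Let affine_lebesgue (m s : R) : {mu : {measure set (measurableTypeR R) -> \bar R} |
  forall A, mu A = (`|s|%:E * leb (affine m s @^-1` A))%E}.
Proof.
have mphi := measurable_affine m s.
by unshelve eexists; [unshelve refine (mscale (NngNum (normr_ge0 s)) (pushforward leb (affine m s)))|].
Qed.

(** By uniqueness of Lebesgue measure it suffices to look at half-open intervals;
    a negative slope turns them into intervals closed on the other side. *)
Lemma lebesgue_measure_affine (m s : R) (A : set (measurableTypeR R)) :
  s != 0 -> measurable A ->
  leb A = (`|s|%:E * leb (affine m s @^-1` A))%E.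
Proof.
move=> s0 mA.
have [mu muE] := affine_lebesgue m s; rewrite -muE.
apply: (@lebesgue_measure_unique _ mu) => //= _ [[a b]] _ <-.
rewrite /= muE.
have [sp|sn|s00] := ltrgtP 0 s; last by rewrite -s00 eqxx in s0.
- rewrite (_ : _ @^-1` _ = `](a - m) / s, (b - m) / s]%classic); last first.
    apply/seteqP; split => x /=; rewrite /affine !in_itv/= ltr_pdivrMr// ler_pdivlMr// [s * x]mulrC.
      by move=> /andP[? ?]; apply/andP; split; lra.
    by move=> /andP[? ?]; apply/andP; split; lra.
  rewrite !lebesgue_measure_itv/= !lte_fin ltr_pM2r ?invr_gt0// ltrD2r.
  case: ifPn => ab; last by rewrite mule0.
  rewrite gtr0_norm//; congr EFin; field; exact: s0.
- rewrite (_ : _ @^-1` _ = `[(b - m) / s, (a - m) / s[%classic); last first.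
    apply/seteqP; split => x /=; rewrite /affine !in_itv/= ltr_ndivlMr// ler_ndivrMr// [s * x]mulrC.
      by move=> /andP[? ?]; apply/andP; split; lra.
    by move=> /andP[? ?]; apply/andP; split; lra.
  rewrite !lebesgue_measure_itv/= !lte_fin ltr_nM2r ?invr_lt0// ltrD2r.
  case: ifPn => ab; last by rewrite mule0.
  rewrite ltr0_norm//; congr EFin; field; exact: s0.
Qed.

Lemma ge0_integral_affine (m s : R) (f : measurableTypeR R -> \bar R) : s != 0 ->
  measurable_fun setT f -> (forall x, 0 <= f x)%E ->
  (\int[leb]_x f x = `|s|%:E * \int[leb]_x f (m + s * x)%R)%E.
Proof.
move=> s0 mf f0.
have mphi := measurable_affine m s.
rewrite (eq_measure_integral (mscale (NngNum (normr_ge0 s)) (pushforward leb (affine m s)))); last first.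
  by move=> A mA _; exact: lebesgue_measure_affine.
rewrite ge0_integral_mscale// ge0_integral_pushforward//=.
Qed.

Lemma ge0_integral_normal_prob (m s : R) (f : measurableTypeR R -> \bar R) :
  measurable_fun setT f -> (forall x, 0 <= f x)%E ->
  (\int[normal_prob m s]_x f x = \int[leb]_x (f x * (normal_pdf m s x)%:E))%E.
Proof.
move=> mf f0; apply: ge0_integral_density => //.
- exact: measurable_normal_pdf.
- exact: normal_pdf_ge0.
Qed.

Local Notation gam := (@normal_prob R 0 1).

Lemma normal_pdf_affine (m s z : R) : s != 0 ->
  `|s| * normal_pdf m s (m + s * z) = normal_pdf 0 1 z.
Proof.
move=> s0; rewrite !normal_pdfE ?oner_neq0// /normal_peak /normal_fun.
rewrite expr1n mul1r -mulrnAr sqrtrM ?sqr_ge0// sqrtr_sqr invfM mulrA mulrA.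
rewrite divff ?normr_eq0// mul1r; congr (_ * expR _).
by field.
Qed.

(** Normal laws are all written as images of the standard one, so that a vanishing
    standard deviation is no exception; this recovers the density when there is one,
    whatever the sign of [s]. *)
Lemma std_normal_affine_density (m s : R) (f : measurableTypeR R -> \bar R) : s != 0 ->
  measurable_fun setT f -> (forall x, 0 <= f x)%E ->
  (\int[gam]_z f (m + s * z)%R = \int[leb]_x (f x * (normal_pdf m s x)%:E))%E.
Proof.
move=> s0 mf f0.
rewrite (ge0_integral_normal_prob 0 1 (f := f \o affine m s)); last 2 first.
- exact: (measurableT_comp mf (measurable_affine m s)).
- by move=> x; exact: f0.
have mfs : measurable_fun setT (fun x : measurableTypeR R => f x * (normal_pdf m s x)%:E)%E.
  apply: emeasurable_funM; first exact: mf.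
  apply/measurable_EFinP; exact: measurable_normal_pdf.
rewrite [RHS](ge0_integral_affine m s0)//; last first.
  by move=> x; rewrite mule_ge0// lee_fin normal_pdf_ge0.
rewrite -ge0_integralZl//.
- by apply: eq_integral => x _; rewrite muleCA -EFinM normal_pdf_affine.
- exact: (measurableT_comp mfs (measurable_affine m s)).
- by move=> x _; rewrite mule_ge0// lee_fin normal_pdf_ge0.
Qed.

Lemma std_normal_integral_cst (c : \bar R) : (\int[gam]_z c = c)%E.
Proof.
rewrite (integral_cst gam measurableT).
by rewrite [X in (_ * X)%E](@probability_setT _ _ _ gam) mule1.
Qed.

(** The standard normal law is symmetric, so only the square of the slope matters. *)
Lemma std_normal_affine_sign (m s t : R) (f : measurableTypeR R -> \bar R) :
  s ^+ 2 = t ^+ 2 ->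
  measurable_fun setT f -> (forall x, 0 <= f x)%E ->
  (\int[gam]_z f (m + s * z)%R = \int[gam]_z f (m + t * z)%R)%E.
Proof.
move=> st mf f0; have [s0|s0] := eqVneq s 0.
  have t0 : t = 0.
    by apply/eqP; move/eqP: st; rewrite s0 expr0n/= eq_sym sqrf_eq0.
  by rewrite s0 t0.
have t0 : t != 0.
  by apply: contra_neq s0 => t0; apply/eqP; rewrite -sqrf_eq0 st t0 expr0n.
rewrite (std_normal_affine_density m s0 mf f0) (std_normal_affine_density m t0 mf f0).
apply: eq_integral => x _; congr (_ * _%:E)%E.
by rewrite !normal_pdfE// /normal_peak /normal_fun st.
Qed.

(** Bayes' formula for a normal observation [x] of a normal parameter [z]: the joint
    density is the marginal one of [x] times a normal density in [z]. *)
Lemma normal_pdf_convolution (m s1 s2 x z : R) : s1 != 0 -> s2 != 0 ->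
  let s := Num.sqrt (s1 ^+ 2 + s2 ^+ 2) in
  normal_pdf (m + s1 * z) s2 x * normal_pdf 0 1 z =
  normal_pdf m s x * normal_pdf (s1 * (x - m) / s ^+ 2) (s2 / s) z.
Proof.
move=> s10 s20 s.
have q1 : 0 < s1 ^+ 2 by rewrite exprn_even_gt0.
have q2 : 0 < s2 ^+ 2 by rewrite exprn_even_gt0.
have s_gt0 : 0 < s by rewrite sqrtr_gt0 addr_gt0.
have sE : s ^+ 2 = s1 ^+ 2 + s2 ^+ 2 by rewrite sqr_sqrtr// ltW// addr_gt0.
have s0 : s != 0 by rewrite gt_eqF.
rewrite !normal_pdfE ?oner_neq0 ?mulf_neq0 ?invr_eq0//.
rewrite [LHS]mulrACA [RHS]mulrACA; congr (_ * _).
  rewrite /normal_peak -!invfM; congr (_^-1).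
  have peak_ge0 (t : R) : 0 <= t ^+ 2 * pi *+ 2.
    by rewrite mulrn_wge0// mulr_ge0 ?pi_ge0// sqr_ge0.
  rewrite -!sqrtrM//.
  by congr Num.sqrt; field; exact: s0.
rewrite /normal_fun -!expRD; congr expR.
have q0 : s1 ^+ 2 + s2 ^+ 2 != 0 by rewrite gt_eqF// addr_gt0.
have -> : (s2 / s) ^+ 2 = s2 ^+ 2 / (s1 ^+ 2 + s2 ^+ 2) by rewrite -sE exprMn exprVn.
by rewrite sE; field; rewrite s20 q0.
Qed.

(** By Tonelli the inner variable can be integrated out of the joint density, where it
    only appears through a probability density. *)
Lemma std_normal_convolution (m s1 s2 : R) (f : measurableTypeR R -> \bar R) :
  measurable_fun setT f -> (forall x, 0 <= f x)%E ->
  (\int[gam]_z1 \int[gam]_z2 f (m + s1 * z1 + s2 * z2)%R =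
   \int[gam]_z f (m + Num.sqrt (s1 ^+ 2 + s2 ^+ 2) * z)%R)%E.
Proof.
move=> mf f0.
have [->|s10] := eqVneq s1 0.
  under eq_integral do rewrite mul0r addr0.
  rewrite std_normal_integral_cst; apply: std_normal_affine_sign => //.
  by rewrite expr0n/= add0r sqr_sqrtr ?sqr_ge0.
have [->|s20] := eqVneq s2 0.
  under eq_integral.
    move=> z _; under eq_integral do rewrite mul0r addr0.
    rewrite std_normal_integral_cst; over.
  apply: std_normal_affine_sign => //.
  by rewrite expr0n/= addr0 sqr_sqrtr ?sqr_ge0.
set s := Num.sqrt _.
have s0 : s != 0.
  by rewrite gt_eqF// sqrtr_gt0 addr_gt0// exprn_even_gt0.
under eq_integral do rewrite (std_normal_affine_density _ s20 mf f0).
rewrite (std_normal_affine_density m s0 mf f0).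
have mpdf : measurable_fun setT
    (fun p : measurableTypeR R * measurableTypeR R => normal_pdf (m + s1 * p.2) s2 p.1).
  under eq_fun do rewrite (normal_pdfE _ s20).
  apply: measurable_funM => //; rewrite /normal_fun; apply: measurableT_comp => //.
  apply: measurable_funM => //; apply: measurableT_comp => //.
  apply: measurable_funX; apply: measurable_funB => //.
  by apply: measurable_funD => //; apply: measurable_funM.
pose F (p : measurableTypeR R * measurableTypeR R) : \bar R :=
  (f p.1 * (normal_pdf (m + s1 * p.2) s2 p.1)%:E)%E.
have mF : measurable_fun setT F.
  apply: emeasurable_funM; last exact/measurable_EFinP.
  exact: (measurableT_comp mf measurable_fst).
have F0 p : (0 <= F p)%E by rewrite mule_ge0// lee_fin normal_pdf_ge0.
transitivity (\int[gam]_z \int[leb]_x F (x, z))%E; first by [].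
rewrite -(fubini_tonelli (m1 := leb) (m2 := gam))//.
apply: eq_integral => x _; rewrite /F /=.
under eq_integral do rewrite muleC.
have mpdfx : measurable_fun setT (fun z : measurableTypeR R => normal_pdf (m + s1 * z) s2 x).
  exact: (measurableT_comp mpdf (measurable_pair1 x)).
rewrite ge0_integralZr//; last 2 first.
- exact/measurable_EFinP.
- by move=> z _; rewrite lee_fin normal_pdf_ge0.
rewrite muleC; congr (_ * _)%E.
rewrite ge0_integral_normal_prob//; last 2 first.
- exact/measurable_EFinP.
- by move=> z; rewrite lee_fin normal_pdf_ge0.
under eq_integral do rewrite -EFinM normal_pdf_convolution// EFinM.
rewrite ge0_integralZl//.
- by rewrite integral_normal_pdf mule1.
- apply/measurable_EFinP; exact: measurable_normal_pdf.
- by move=> z _; rewrite lee_fin normal_pdf_ge0.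
- by rewrite lee_fin normal_pdf_ge0.
Qed.

End gauss1.

(** * Linear functionals of a Gaussian vector *)

Section gaussK.
Context {R : realType}.
Local Notation leb := (@lebesgue_measure R).
Local Notation gam := (@normal_prob R 0 1).

(** Vectors and matrices are functions of their indices: the induction on the
    dimension peels off the first index, which composition with [lift ord0] does
    without casts between dimensions. *)
Definition dotf K (u v : 'I_K -> R) : R := \sum_(i < K) u i * v i.
Definition quadf K (Q : 'I_K -> 'I_K -> R) (u : 'I_K -> R) : R :=
  \sum_(i < K) u i * dotf (Q i) u.
Definition posdeff K (Q : 'I_K -> 'I_K -> R) : Prop :=
  (forall i j, Q i j = Q j i) /\
  forall u, (exists i, u i != 0) -> 0 < quadf Q u.

Definition schur K (Q : 'I_K.+1 -> 'I_K.+1 -> R) (i j : 'I_K) : R :=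
  Q (lift ord0 i) (lift ord0 j) -
  Q ord0 (lift ord0 i) * Q ord0 (lift ord0 j) / Q ord0 ord0.

Lemma dotf_recl K (u v : 'I_K.+1 -> R) :
  dotf u v = u ord0 * v ord0 + dotf (u \o lift ord0) (v \o lift ord0).
Proof. by rewrite /dotf big_ord_recl. Qed.

(** Completing the square in the first coordinate. *)
Lemma quadf_recl K (Q : 'I_K.+1 -> 'I_K.+1 -> R) (u : 'I_K.+1 -> R) :
  (forall i j, Q i j = Q j i) -> Q ord0 ord0 != 0 ->
  quadf Q u = Q ord0 ord0 *
    (u ord0 + dotf (Q ord0 \o lift ord0) (u \o lift ord0) / Q ord0 ord0) ^+ 2
    + quadf (schur Q) (u \o lift ord0).
Proof.
move=> symQ q0; set r := dotf _ _.
rewrite /quadf big_ord_recl dotf_recl -/r.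
have -> : \sum_(i < K) u (lift ord0 i) * dotf (Q (lift ord0 i)) u =
    u ord0 * r + \sum_(i < K) u (lift ord0 i) * dotf (Q (lift ord0 i) \o lift ord0) (u \o lift ord0).
  rewrite /r /dotf mulr_sumr -big_split/=; apply: eq_bigr => i _.
  by rewrite big_ord_recl (symQ (lift ord0 i) ord0); ring.
have -> : \sum_(i < K) (u \o lift ord0) i * dotf (schur Q i) (u \o lift ord0) =
    \sum_(i < K) u (lift ord0 i) * dotf (Q (lift ord0 i) \o lift ord0) (u \o lift ord0)
    - r ^+ 2 / Q ord0 ord0.
  have rE : r = \sum_(i < K) Q ord0 (lift ord0 i) * u (lift ord0 i) by [].
  rewrite expr2 -mulrA {1}rE mulr_suml -sumrB; apply: eq_bigr => i _ /=.
  rewrite (_ : dotf (schur Q i) _ = dotf (Q (lift ord0 i) \o lift ord0) (u \o lift ord0)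
    - Q ord0 (lift ord0 i) / Q ord0 ord0 * r); first by ring.
  by rewrite rE /dotf mulr_sumr -sumrB; apply: eq_bigr => j _; rewrite /schur/=; ring.
by field.
Qed.

Lemma posdeff_diag K (Q : 'I_K -> 'I_K -> R) i : posdeff Q -> 0 < Q i i.
Proof.
move=> [_ /(_ (fun j => (j == i)%:R))].
have -> : quadf Q (fun j => (j == i)%:R) = Q i i.
  rewrite /quadf (bigD1 i)//= eqxx mul1r big1 ?addr0; last first.
    by move=> j /negbTE ->; rewrite mul0r.
  rewrite /dotf (bigD1 i)//= eqxx mulr1 big1 ?addr0// => j /negbTE ->.
  by rewrite mulr0.
by apply; exists i; rewrite eqxx oner_neq0.
Qed.

Lemma quadf_ge0 K (Q : 'I_K -> 'I_K -> R) (u : 'I_K -> R) : posdeff Q -> 0 <= quadf Q u.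
Proof.
move=> [_ Qpos]; have [[i ui]|u0] := pselect (exists i, u i != 0).
  by apply/ltW/Qpos; exists i.
rewrite /quadf big1// => i _; have [->|ui] := eqVneq (u i) 0; first by rewrite mul0r.
by exfalso; apply: u0; exists i.
Qed.

Lemma posdeff_schur K (Q : 'I_K.+1 -> 'I_K.+1 -> R) : posdeff Q -> posdeff (schur Q).
Proof.
move=> pQ; have q0 := posdeff_diag ord0 pQ; case: pQ => symQ posQ.
split=> [i j|u [i ui]]; first by rewrite /schur symQ; congr (_ - _); rewrite [in RHS]mulrAC mulrAC -mulrA mulrCA mulrA mulrAC.
(* The first coordinate that cancels the completed square. *)
pose u' (j : 'I_K.+1) := if unlift ord0 j is Some k then u k
  else - dotf (Q ord0 \o lift ord0) u / Q ord0 ord0.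
have u'u : u' \o lift ord0 = u by apply/funext => j; rewrite /u'/= liftK.
have := posQ u'; rewrite quadf_recl ?gt_eqF// u'u.
rewrite [u' ord0]/u' unlift_none mulNr addNr expr0n/= mulr0 add0r; apply.
by exists (lift ord0 i); rewrite /u' liftK.
Qed.

Lemma tnth_cons_comp K (x : R) (b : K.-tuple R) :
  tnth [tuple of x :: b] \o lift ord0 = tnth b.
Proof. by apply/funext => i; rewrite /= tnthS. Qed.

Lemma measurable_dotf_tnth K (v : 'I_K -> R) :
  measurable_fun setT (fun b : K.-tuple R => dotf v (tnth b)).
Proof.
apply: measurable_sum => i; apply: measurable_funM => //; exact: measurable_tnth.
Qed.

Lemma measurable_quadf_tnth K (Q : 'I_K -> 'I_K -> R) :
  measurable_fun setT (fun b : K.-tuple R => quadf Q (tnth b)).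
Proof.
apply: measurable_sum => i; apply: measurable_funM; first exact: measurable_tnth.
exact: measurable_dotf_tnth.
Qed.

(** The integral over the first coordinate once the square is completed: [t] and [x]
    stand for the contributions of the other coordinates to the square and to the
    functional, [q] for the leading entry of the precision matrix. *)
Lemma gaussian_square_integral (q l v x t : R) (f : measurableTypeR R -> \bar R) :
  0 < q -> measurable_fun setT f -> (forall y, 0 <= f y)%E ->
  (\int[leb]_y (f (v * y + x)%R * (expR (l * y - q * (y + t / q) ^+ 2 / 2))%:E) =
  (Num.sqrt (2 * pi / q) * expR (l ^+ 2 / (2 * q) - l * t / q))%:E *
  \int[gam]_z f ((v * (l - t) / q + x) + v / Num.sqrt q * z)%R)%E.
Proof.
move=> q0 mf f0.
pose s := (Num.sqrt q)^-1.
have s0 : s != 0 by rewrite invr_eq0 gt_eqF// sqrtr_gt0.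
have sE : s ^+ 2 = q^-1 by rewrite exprVn sqr_sqrtr// ltW.
pose m := (l - t) / q.
pose h (y : measurableTypeR R) := f (v * y + x)%R.
have mh : measurable_fun setT h.
  by apply: (measurableT_comp mf); apply: measurable_funD => //; apply: measurable_funM.
have h0 y : (0 <= h y)%E by exact: f0.
have := @std_normal_affine_density R m s h s0 mh h0.
rewrite (_ : (fun z => h (m + s * z)%R) =
  (fun z => f ((v * (l - t) / q + x) + v / Num.sqrt q * z)%R)); last first.
  by apply/funext => z; rewrite /h /m /s; congr f; ring.
move=> ->.
rewrite -ge0_integralZl//; last 2 first.
- apply: emeasurable_funM; first exact: mh.
  apply/measurable_EFinP; exact: measurable_normal_pdf.
- by move=> y _; rewrite mule_ge0// lee_fin normal_pdf_ge0.
apply: eq_integral => y _; rewrite muleCA -EFinM; congr (_ * _%:E)%E.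
rewrite normal_pdfE// /normal_peak /normal_fun sE.
have -> : Num.sqrt (q^-1 * pi *+ 2) = Num.sqrt (2 * pi / q).
  by congr Num.sqrt; ring.
have k0 : Num.sqrt (2 * pi / q) != 0.
  by rewrite gt_eqF// sqrtr_gt0 divr_gt0// mulr_gt0// pi_gt0.
rewrite mulrACA divff// mul1r -expRD; congr expR.
by rewrite /m; field; rewrite gt_eqF.
Qed.

(** Under a density proportional to [exp (l^T b - b^T Q b / 2)], the functional
    [b |-> (Q p)^T b] is normal with mean [p^T l] and variance [p^T Q p]. Giving the
    functional through [p] keeps inverse matrices out of the induction: the first
    entry of [p] drops out, and its other entries serve for the Schur complement.
    The constant is the same for all test functions [f], so it disappears when the
    density is normalized. *)
Lemma gaussian_linear_form K (Q : 'I_K -> 'I_K -> R) (p l : 'I_K -> R) :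
  posdeff Q -> exists2 C : R, 0 < C &
  forall f : measurableTypeR R -> \bar R,
    measurable_fun setT f -> (forall y, 0 <= f y)%E ->
  (\int[@lebesgue_tuple R K]_b (f (dotf (fun i => dotf (Q i) p) (tnth b)) *
     (expR (dotf l (tnth b) - quadf Q (tnth b) / 2))%:E) =
   C%:E * \int[gam]_z f (dotf p l + Num.sqrt (quadf Q p) * z)%R)%E.
Proof.
elim: K => [|K IH] in Q p l *.
  move=> _; exists 1 => // f mf f0.
  rewrite /= integral_dirac//; last first.
    apply: emeasurable_funM => //.
      apply: (measurableT_comp mf); exact: measurable_dotf_tnth.
    apply/measurable_EFinP; apply: measurableT_comp => //.
    apply: measurable_funB; first exact: measurable_dotf_tnth.
    by apply: measurable_funM => //; exact: measurable_quadf_tnth.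
  rewrite diracT mul1e /quadf /dotf !big_ord0 mul0r subr0 expR0 mule1 mul1e.
  rewrite sqrtr0; under eq_integral do rewrite mul0r addr0.
  by rewrite std_normal_integral_cst.
move=> pQ; have q0 := posdeff_diag ord0 pQ; have symQ := pQ.1.
set q := Q ord0 ord0 in q0 *.
have qn0 : q != 0 by rewrite gt_eqF.
pose r := Q ord0 \o lift ord0.
pose p' := p \o lift ord0.
pose v0 := dotf (Q ord0) p.
have v0E : v0 = q * p ord0 + dotf r p' by rewrite /v0 dotf_recl.
pose v' i := dotf (Q (lift ord0 i)) p.
pose l2 i := l (lift ord0 i) - l ord0 * r i / q.
have [C' C'0 HC] := IH (schur Q) p' l2 (posdeff_schur pQ).
pose k := Num.sqrt (2 * pi / q) * expR (l ord0 ^+ 2 / (2 * q)).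
have k0 : 0 < k.
  by rewrite mulr_gt0 ?expR_gt0// sqrtr_gt0 divr_gt0// mulr_gt0// pi_gt0.
exists (k * C') => [|f mf f0]; first by rewrite mulr_gt0.
(* [w] is what remains of the functional after the first coordinate has been replaced
   by its conditional mean, and [f2] averages [f] over the fluctuation around it. *)
pose w i := dotf (schur Q i) p'.
have wE i : w i = v' i - v0 * r i / q.
  rewrite /w /v' v0E dotf_recl -/p' -[Q _ ord0]symQ.
  have -> : dotf (schur Q i) p' = dotf (Q (lift ord0 i) \o lift ord0) p' - r i / q * dotf r p'.
    by rewrite /dotf mulr_sumr -sumrB; apply: eq_bigr => j _; rewrite /schur /r /= -/q; ring.
  by rewrite /r /=; field.
pose f2 (y : measurableTypeR R) : \bar R :=
  (\int[gam]_z f (v0 * l ord0 / q + y + v0 / Num.sqrt q * z)%R)%E.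
have f20 y : (0 <= f2 y)%E by apply: integral_ge0 => z _; exact: f0.
have mf2 : measurable_fun setT f2.
  pose F (z : measurableTypeR R * measurableTypeR R) : \bar R :=
    f (v0 * l ord0 / q + z.1 + v0 / Num.sqrt q * z.2)%R.
  apply: (measurable_fun_fubini_tonelli_F (m2 := gam) F) => [|z]; last exact: f0.
  apply: (measurableT_comp mf); apply: measurable_funD.
    by apply: measurable_funD => //; exact: measurable_fst.
  by apply: measurable_funM => //; exact: measurable_snd.
pose G (b : K.+1.-tuple R) : \bar R := (f (dotf (fun i => dotf (Q i) p) (tnth b)) *
     (expR (dotf l (tnth b) - quadf Q (tnth b) / 2))%:E)%E.
have G0 b : (0 <= G b)%E by rewrite mule_ge0// lee_fin expR_ge0.
have mG : measurable_fun setT G.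
  apply: emeasurable_funM.
    apply: (measurableT_comp mf); exact: measurable_dotf_tnth.
  apply/measurable_EFinP; apply: measurableT_comp => //.
  apply: measurable_funB; first exact: measurable_dotf_tnth.
  by apply: measurable_funM => //; exact: measurable_quadf_tnth.
pose cns (x : measurableTypeR R * K.-tuple R) : K.+1.-tuple R :=
  [tuple of (x.1 : R) :: x.2].
have mcns : measurable_fun setT cns by apply: measurable_cons.
transitivity (\int[(leb \x @lebesgue_tuple R K)%E]_x G (cns x))%E.
  rewrite -[LHS]/(\int[pushforward (leb \x @lebesgue_tuple R K)%E cns]_b G b)%E.
  by rewrite ge0_integral_pushforward.
have mGc : measurable_fun setT (G \o cns) by exact: measurableT_comp.
rewrite (fubini_tonelli2 (m1 := leb) (m2 := @lebesgue_tuple R K) (G \o cns))//=.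
transitivity (\int[@lebesgue_tuple R K]_b (k%:E * (f2 (dotf w (tnth b)) *
     (expR (dotf l2 (tnth b) - quadf (schur Q) (tnth b) / 2))%:E)))%E.
  apply: eq_integral => b _; rewrite /fubini_G /=.
  pose t := dotf r (tnth b).
  pose x := dotf v' (tnth b).
  pose e := dotf (l \o lift ord0) (tnth b) - quadf (schur Q) (tnth b) / 2.
  transitivity (\int[leb]_y ((f (v0 * y + x)%R *
     (expR (l ord0 * y - q * (y + t / q) ^+ 2 / 2))%:E) * (expR e)%:E))%E.
    apply: eq_integral => y _.
    rewrite /G /= quadf_recl// !dotf_recl /= tnth_cons_comp -/q -/r -/t.
    rewrite -/v0 -/(dotf v' (tnth b)) -/x -muleA -EFinM -expRD.
    have -> : tnth (cns (y, b)) ord0 = y by rewrite (tnth_nth 0).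
    congr (f _ * (expR _)%:E)%E; first by rewrite v0E.
    by rewrite /e /=; ring.
  have mexp : measurable_fun setT (fun y : measurableTypeR R =>
      expR (l ord0 * y - q * (y + t / q) ^+ 2 / 2)).
    apply: measurableT_comp => //; apply: measurable_funB; first exact: measurable_funM.
    apply: measurable_funM => //; apply: measurable_funM => //.
    by apply: measurable_funX; exact: measurable_funD.
  rewrite ge0_integralZr//; last 2 first.
  - apply: emeasurable_funM; last exact/measurable_EFinP.
    by apply: (measurableT_comp mf); apply: measurable_funD => //; exact: measurable_funM.
  - by move=> y _; rewrite mule_ge0// lee_fin expR_ge0.
  rewrite gaussian_square_integral//.
  have -> : (\int[gam]_z f ((v0 * (l ord0 - t) / q + x) + v0 / Num.sqrt q * z)%R)%E =
      f2 (dotf w (tnth b)).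
    apply: eq_integral => z _; congr (f (_ + _)).
    rewrite (_ : dotf w (tnth b) = x - v0 / q * t); first by ring.
    by rewrite /x /t /dotf mulr_sumr -sumrB; apply: eq_bigr => i _; rewrite wE; ring.
  rewrite muleAC [RHS]muleCA [LHS]muleC; congr (_ * _)%E.
  rewrite -!EFinM /k -!mulrA -!expRD; congr (_ * expR _)%:E.
  rewrite (_ : dotf l2 (tnth b) = dotf (l \o lift ord0) (tnth b) - l ord0 / q * t).
    by rewrite /e; ring.
  by rewrite /l2 /t /dotf mulr_sumr -sumrB; apply: eq_bigr => i _ /=; ring.
rewrite ge0_integralZl//; last 3 first.
- apply: emeasurable_funM.
    apply: (measurableT_comp mf2); exact: measurable_dotf_tnth.
  apply/measurable_EFinP; apply: measurableT_comp => //.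
  apply: measurable_funB; first exact: measurable_dotf_tnth.
  by apply: measurable_funM => //; exact: measurable_quadf_tnth.
- by move=> b _; rewrite mule_ge0// lee_fin expR_ge0.
- by rewrite lee_fin ltW.
rewrite HC// EFinM muleA; congr (_ * _)%E; rewrite /f2.
pose s1 := Num.sqrt (quadf (schur Q) p').
transitivity (\int[gam]_z1 \int[gam]_z2
    f ((v0 * l ord0 / q + dotf p' l2) + s1 * z1 + v0 / Num.sqrt q * z2)%R)%E.
  by apply: eq_integral => z1 _; apply: eq_integral => z2 _; rewrite addrA.
rewrite std_normal_convolution//; apply: eq_integral => z _; congr (f (_ + _ * _)).
  rewrite (dotf_recl p) -/p' (_ : dotf p' l2 = dotf p' (l \o lift ord0) - l ord0 / q * dotf r p').
    by rewrite v0E; field.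
  by rewrite /l2 /dotf mulr_sumr -sumrB; apply: eq_bigr => i _ /=; ring.
congr Num.sqrt; rewrite quadf_recl// -/q -/r -/p' /s1 sqr_sqrtr; last first.
  exact/quadf_ge0/posdeff_schur.
rewrite addrC expr_div_n sqr_sqrtr ?(ltW q0)// v0E; congr (_ + _).
by field.
Qed.

End gaussK.

(** * Positive definite matrices *)

Section posmx.
Context {R : realType}.

Lemma quadf_mx K (S : 'M[R]_K) (u : 'cV[R]_K) :
  (u^T *m S *m u) ord0 ord0 = quadf S (fun k => u k ord0).
Proof.
rewrite -mulmxA mxE; apply: eq_bigr => k _; rewrite !mxE; congr (_ * _).
Qed.

Lemma posdeff_mx K (S : 'M[R]_K) : posdefmx S -> posdeff S.
Proof.
move=> [symS posS]; split=> [i j|u [i ui]]; first by rewrite -[in LHS]symS mxE.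
have := posS (\col_k u k); rewrite quadf_mx.
rewrite (_ : (fun k => _) = u); last by apply/funext => k; rewrite mxE.
apply; apply: contra_neq ui => /colP/(_ i); by rewrite !mxE.
Qed.

(** Eliminating the first column multiplies by a matrix of determinant 1 and leaves
    the leading entry and the Schur complement on the diagonal. *)
Lemma det_gt0 K (S : 'M[R]_K) : posdeff S -> 0 < \det S.
Proof.
elim: K => [|K IH] in S *; first by rewrite det_mx00.
move=> pS; have q0 := posdeff_diag ord0 pS.
pose S' : 'M[R]_(1 + K) := S.
pose q := S ord0 ord0.
pose L : 'M[R]_(1 + K) := block_mx 1%:M 0 (- q^-1 *: dlsubmx S') 1%:M.
pose D : 'M[R]_K := \matrix_(i, j) schur S i j.
have l0 (j : 'I_1) : lshift K j = ord0 :> 'I_K.+1 by rewrite ord1; exact: val_inj.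
have r0 (i : 'I_K) : rshift 1 i = lift ord0 i :> 'I_K.+1 by exact: val_inj.
have LS : L *m S' = block_mx (ulsubmx S') (ursubmx S') 0 D.
  rewrite -[S' in LHS]submxK /L mulmx_block !mul1mx !mul0mx !addr0; congr block_mx.
  - apply/matrixP => i j; rewrite !mxE big_ord1 !mxE !l0 r0 -/q.
    by field; rewrite gt_eqF.
  - apply/matrixP => i j; rewrite !mxE big_ord1 !mxE !l0 !r0.
    by rewrite /schur -/q (pS.1 (lift ord0 i) ord0); ring.
have : \det L * \det S = q * \det D.
  rewrite -det_mulmx LS det_ublock; congr (_ * _).
  by rewrite det_mx11 !mxE; congr (S _ _); exact: val_inj.
rewrite /L det_lblock !det1 !mul1r => ->; apply: mulr_gt0 => //.
apply: IH; rewrite (_ : fun_of_matrix D = schur S).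
  exact: posdeff_schur.
by apply/funext => i; apply/funext => j; rewrite mxE.
Qed.

Lemma posdefmx_invmx K (S : 'M[R]_K) : posdefmx S -> posdefmx (invmx S).
Proof.
move=> pS; have uS : S \in unitmx by rewrite unitmxE unitfE gt_eqF// det_gt0//; exact: posdeff_mx.
case: pS => symS posS; split; first by rewrite trmx_inv symS.
move=> u u0; have -> : u^T *m invmx S *m u = (invmx S *m u)^T *m S *m (invmx S *m u).
  by rewrite trmx_mul trmx_inv symS -!mulmxA (mulmxA S) mulmxV// mul1mx.
apply: posS; apply: contra_neq u0 => Su0.
by rewrite -(mul1mx u) -(mulmxV uS) -mulmxA Su0 mulmx0.
Qed.

End posmx.

(** * The posterior law of the functional *)

Section posterior_law.
Context {R : realType} (n K : nat).
Local Notation gam := (@normal_prob R 0 1).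
Variables (Om : 'I_K -> interval R) (S : 'M[R]_K) (y : 'I_n -> R).
Hypothesis pS : posdefmx S.

Definition in_block (i : 'I_n) (k : 'I_K) : R := (design i \in Om k)%:R.
(** Precision matrix of the posterior: Gram matrix of the regressors plus inverse
    prior covariance. *)
Definition precision (k l : 'I_K) : R :=
  \sum_(i < n) in_block i k * in_block i l + invmx S k l.
Definition score (k : 'I_K) : R := \sum_(i < n) in_block i k * y i.

Lemma quadf_precision (u : 'I_K -> R) :
  quadf precision u = \sum_(i < n) (dotf (in_block i) u) ^+ 2 + quadf (invmx S) u.
Proof.
transitivity (\sum_(k < K) (\sum_(i < n) u k * in_block i k * dotf (in_block i) u
   + u k * dotf (invmx S k) u)).
  apply: eq_bigr => k _; under eq_bigr do rewrite -mulrA.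
  rewrite -mulr_sumr -mulrDr; congr (_ * _).
  rewrite /dotf; under [in RHS]eq_bigr do rewrite mulr_sumr.
  rewrite exchange_big -big_split; apply: eq_bigr => l _ /=.
  rewrite /precision mulrDl mulr_suml; congr (_ + _).
  by apply: eq_bigr => i _; ring.
rewrite big_split/= exchange_big/=; congr (_ + _); apply: eq_bigr => i _.
by rewrite expr2 -mulr_suml; congr (_ * _); apply: eq_bigr => k _; rewrite mulrC.
Qed.

Lemma posdeff_precision : posdeff precision.
Proof.
have [symI posI] := posdeff_mx (posdefmx_invmx pS).
split=> [k l|u u0]; last first.
  rewrite quadf_precision ltr_wpDl ?posI//.
  by apply: sumr_ge0 => i _; exact: sqr_ge0.
rewrite /precision symI; congr (_ + _); apply: eq_bigr => i _; exact: mulrC.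
Qed.

Lemma stepE (b : 'I_K -> R) i : step Om b (design i) = dotf (in_block i) b.
Proof. by []. Qed.

(** The factors of likelihood times prior that do not involve the step heights. It has
    to be nonzero for the posterior to be the normalized joint measure. *)
Definition evidence_cst : R :=
  (\prod_(i < n) (normal_peak 1 * expR (- (y i ^+ 2 / 2)))) *
  (Num.sqrt ((2 * pi) ^+ K * \det S))^-1.

Lemma evidence_cst_gt0 : 0 < evidence_cst.
Proof.
rewrite mulr_gt0//; first by apply: prodr_gt0 => i _; rewrite mulr_gt0 ?expR_gt0 ?normal_peak_gt0 ?oner_neq0.
rewrite invr_gt0 sqrtr_gt0 mulr_gt0 ?exprn_gt0 ?mulr_gt0 ?pi_gt0//.
exact/det_gt0/posdeff_mx.
Qed.

Lemma likelihood_prior (b : K.-tuple R) :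
  likelihood Om y b * multinormal_pdf S b =
  evidence_cst * expR (dotf score (tnth b) - quadf precision (tnth b) / 2).
Proof.
rewrite /multinormal_pdf quadf_mx.
rewrite (_ : (fun k => _) = tnth b); last by apply/funext => k; rewrite mxE.
have -> : likelihood Om y b =
  (\prod_(i < n) (normal_peak 1 * expR (- (y i ^+ 2 / 2)))) *
  expR (dotf score (tnth b) - \sum_(i < n) dotf (in_block i) (tnth b) ^+ 2 / 2).
  rewrite (_ : dotf score (tnth b) = \sum_(i < n) y i * dotf (in_block i) (tnth b)).
    rewrite -sumrB expR_sum -big_split/=; apply: eq_bigr => i _.
    rewrite normal_pdfE ?oner_neq0// -mulrA -expRD stepE; congr (_ * expR _).
    by rewrite expr1n; field.
  rewrite /dotf /score; under [RHS]eq_bigr do rewrite mulr_sumr.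
  rewrite exchange_big; apply: eq_bigr => k _ /=; rewrite mulr_suml.
  by apply: eq_bigr => i _; ring.
rewrite mulrACA -expRD /evidence_cst quadf_precision; congr (_ * expR _).
by rewrite -mulr_suml; ring.
Qed.

(** The joint measure of the event that the functional lies in [B] is a Gaussian
    integral of the kind above; dividing by its value for the whole space removes the
    constants. *)
Lemma posterior_error_lawE (a : R -> R) (c : R) (p : 'I_K -> R) :
  (forall k, dotf (precision k) p = n%:R^-1 * \sum_(i < n) a (design i) * in_block i k) ->
  forall B : set (measurableTypeR R), measurable B ->
  posterior_error_law a Om S y c B =
  gam (affine (Num.sqrt n%:R * (dotf p score - c))
    (Num.sqrt n%:R * Num.sqrt (quadf precision p)) @^-1` B).
Proof.
move=> hp.
have [C C0 HC] := gaussian_linear_form p score posdeff_precision.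
pose g : measurableTypeR R -> measurableTypeR R := affine (- (Num.sqrt n%:R * c)) (Num.sqrt n%:R).
have mg : measurable_fun setT g by exact: measurable_affine.
have gE b : scaled_error n a Om c b = g (dotf (fun k => dotf (precision k) p) (tnth b)).
  rewrite /scaled_error /g /affine mulrBr addrC; congr (- _ + _ * _).
  rewrite /innerL; under [in RHS]eq_fun do rewrite hp.
  rewrite /dotf; under [RHS]eq_bigr do rewrite -mulrA.
  rewrite -mulr_sumr; congr (_ * _).
  under [RHS]eq_bigr do rewrite mulr_suml.
  rewrite exchange_big; apply: eq_bigr => i _ /=.
  by rewrite stepE /dotf mulr_sumr; apply: eq_bigr => k _; ring.
pose E := evidence_cst.
have jointE (B : set (measurableTypeR R)) : measurable B ->
    joint Om S y (scaled_error n a Om c @^-1` B) =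
    ((E * C)%:E * gam (affine (Num.sqrt n%:R * (dotf p score - c))
    (Num.sqrt n%:R * Num.sqrt (quadf precision p)) @^-1` B))%E.
  move=> mB.
  rewrite /joint integral_mkcond.
  pose f (x : measurableTypeR R) : \bar R := (\1_B (g x))%:E.
  have mf : measurable_fun setT f.
    by apply/measurable_EFinP; apply: measurableT_comp.
  have f0 x : (0 <= f x)%E by rewrite lee_fin.
  pose h (b : K.-tuple R) : \bar R :=
    (f (dotf (fun k => dotf (precision k) p) (tnth b)) * (likelihood Om y b)%:E)%E.
  have mfd : measurable_fun setT (fun b : K.-tuple R => f (dotf (fun k => dotf (precision k) p) (tnth b))).
    apply: (measurableT_comp mf); exact: measurable_dotf_tnth.
  have mh : measurable_fun setT h.
    apply: emeasurable_funM => //; apply/measurable_EFinP; exact: measurable_likelihood.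
  have h0 b : (0 <= h b)%E by rewrite mule_ge0// lee_fin likelihood_ge0.
  transitivity (\int[multinormal S]_b h b)%E.
    apply: eq_integral => b _; rewrite patchE /h /f indicE -gE.
    by rewrite (_ : (b \in _) = (scaled_error n a Om c b \in B)); [case: ifP => _; rewrite ?mul1e ?mul0e|apply/idP/idP; rewrite !inE].
  rewrite (@ge0_integral_density _ _ _ (@lebesgue_tuple R K) (multinormal S) (multinormal_pdf S))//; last 2 first.
  - exact: measurable_multinormal_pdf.
  - exact: multinormal_pdf_ge0.
  transitivity (\int[@lebesgue_tuple R K]_b (E%:E *
     (f (dotf (fun k => dotf (precision k) p) (tnth b)) *
      (expR (dotf score (tnth b) - quadf precision (tnth b) / 2))%:E)))%E.
    apply: eq_integral => b _.
    by rewrite /h -muleA -EFinM likelihood_prior EFinM [RHS]muleCA.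
  rewrite ge0_integralZl//; last 3 first.
  - apply: emeasurable_funM => //.
    apply/measurable_EFinP; apply: measurableT_comp => //.
    apply: measurable_funB; first exact: measurable_dotf_tnth.
    by apply: measurable_funM => //; exact: measurable_quadf_tnth.
  - by move=> b _; rewrite mule_ge0// lee_fin expR_ge0.
  - by rewrite lee_fin ltW// evidence_cst_gt0.
  rewrite HC// muleA -EFinM; congr (_ * _)%E.
  set A := _ @^-1` B.
  rewrite -[A]setIT -integral_indic//; last first.
    by rewrite /A -[X in measurable X]setTI; exact: measurable_affine.
  apply: eq_integral => z _; rewrite /f /A !indicE.
  rewrite (_ : (z \in _) = (affine (Num.sqrt n%:R * (dotf p score - c))
    (Num.sqrt n%:R * Num.sqrt (quadf precision p)) z \in B)) //.
  by rewrite (_ : g _ = affine (Num.sqrt n%:R * (dotf p score - c))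
    (Num.sqrt n%:R * Num.sqrt (quadf precision p)) z) // /g /affine; ring.
move=> B mB; rewrite /posterior_error_law /distribution /pushforward.
have := jointE setT measurableT; rewrite !preimage_setT.
rewrite [X in (_ * X)%E](@probability_setT _ _ _ gam) mule1 => jT.
have EC0 : 0 < E * C by rewrite mulr_gt0// evidence_cst_gt0.
have {}jT : joint Om S y [set: K.-tuple R] = (E * C)%:E by exact: jT.
rewrite /posterior /= /mnormalize /= jT gt_eqF ?lte_fin//= jointE// muleAC -EFinM.
by rewrite divff ?mul1e// gt_eqF.
Qed.

End posterior_law.

(** * The least eigenvalue bounds the quadratic form from below *)

Section rayleigh.
Context {R : realType} (K : nat).

Lemma dotf_ge0 (u : 'I_K -> R) : 0 <= dotf u u.
Proof. by apply: sumr_ge0 => i _; rewrite -expr2 sqr_ge0. Qed.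

Lemma dotf_gt0 (u : 'I_K -> R) i : u i != 0 -> 0 < dotf u u.
Proof.
move=> ui; rewrite /dotf (bigD1 i)//= ltr_pwDl//.
  by rewrite -expr2 exprn_even_gt0.
by apply: sumr_ge0 => j _; rewrite -expr2 sqr_ge0.
Qed.

Lemma quadf_upper_bound (N : 'I_K -> 'I_K -> R) : exists2 b : R, 0 < b &
  forall u : 'I_K -> R, quadf N u <= b * dotf u u.
Proof.
pose b := \sum_(i < K) \sum_(j < K) `|N i j|.
have b0 : 0 <= b by apply: sumr_ge0 => i _; apply: sumr_ge0.
have sqle (u : 'I_K -> R) i : u i ^+ 2 <= dotf u u.
  rewrite /dotf (bigD1 i)//= -expr2 lerDl.
  by apply: sumr_ge0 => j _; rewrite -expr2 sqr_ge0.
exists (b + 1) => [|u]; first by rewrite ltr_wpDl.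
rewrite mulrDl mul1r ler_wpDr ?dotf_ge0//.
rewrite /b mulr_suml; apply: ler_sum => i _; rewrite mulr_suml mulr_sumr.
apply: ler_sum => j _; rewrite mulrCA (le_trans (ler_norm _))// !normrM.
apply: ler_wpM2l => //; rewrite -normrM.
have := sqle u i; have := sqle u j; rewrite ler_norml => ? ?.
have := sqr_ge0 (u i - u j); have := sqr_ge0 (u i + u j).
by rewrite !expr2 in sqle *; move=> ? ?; apply/andP; split; lra.
Qed.

(** Let [L] be the infimum of the Rayleigh quotient and [M = S - L]. The form of [M] is
    nonnegative. If [M] were invertible with inverse [N], evaluating it at
    [x - t N x] would give [0 <= x^T M x - 2 t |x|^2 + t^2 x^T N x], so that
    [x^T M x >= |x|^2 / b] for [t = 1 / b] and any bound [b] of [N], against the choice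
    of [L]. Hence [L] is an eigenvalue. *)
Lemma lambda_min_rayleigh (S : 'M[R]_K) (c : R) : posdefmx S ->
  c < lambda_min S -> forall u : 'I_K -> R, c * dotf u u <= quadf S u.
Proof.
move=> pS cS u; rewrite leNgt; apply/negP => uc.
have pf := posdeff_mx pS.
have [[i ui]|u0] := pselect (exists i, u i != 0); last first.
  move: uc; rewrite ltNge; apply/negP/negPn.
  have u0' i : u i = 0 by apply: contrapT => /eqP ui; apply: u0; exists i.
  by rewrite /dotf big1 ?mulr0 ?quadf_ge0// => i _; rewrite u0' mul0r.
have uu0 := dotf_gt0 ui.
pose E : set R := [set quadf S w / dotf w w | w in [set w | exists i, w i != 0]].
have E0 : E !=set0 by exists (quadf S u / dotf u u); exists u => //; exists i.
have Elb : has_lbound E.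
  by exists 0 => _ [w [j wj] <-]; rewrite divr_ge0 ?quadf_ge0// dotf_ge0.
pose L := inf E.
have Lc : L < c.
  apply: (@le_lt_trans _ _ (quadf S u / dotf u u)); last by rewrite ltr_pdivrMr.
  by apply: ge_inf => //; exists u => //; exists i.
have [M ME] : exists M, M = S - L%:M by exists (S - L%:M).
have quadM (w : 'I_K -> R) : quadf M w = quadf S w - L * dotf w w.
  rewrite /quadf /dotf mulr_sumr -sumrB; apply: eq_bigr => j _.
  rewrite (mulrCA L) -mulrBr; congr (_ * _).
  rewrite (eq_bigr (fun k => S j k * w k - (j == k)%:R * (L * w k))); last first.
    by move=> k _; rewrite ME !mxE; case: (j == k) => /=; ring.
  rewrite sumrB; congr (_ - _); rewrite (bigD1 j)//= eqxx mul1r big1 ?addr0//.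
  by move=> k; rewrite eq_sym => /negbTE ->; rewrite mul0r.
have M0 (w : 'I_K -> R) : 0 <= quadf M w.
  have [[j wj]|w0] := pselect (exists i, w i != 0); last first.
    rewrite /quadf big1// => j _; have [->|wj] := eqVneq (w j) 0; first by rewrite mul0r.
    by exfalso; apply: w0; exists j.
  rewrite quadM subr_ge0 -ler_pdivlMr ?(dotf_gt0 wj)//.
  by apply: ge_inf => //; exists w => //; exists j.
have symM : M^T = M by rewrite ME linearB/= tr_scalar_mx pS.1.
have [uM|nuM] := boolP (M \in unitmx); last first.
  have eL : eigenvalue S L.
    by rewrite /eigenvalue /eigenspace -ME kermx_eq0 row_free_unit.
  suff : lambda_min S <= L by rewrite leNgt (lt_trans Lc).
  apply: ge_inf => //; exists 0 => l /= /eigenvalueP[v vS v0].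
  have [j vj] : exists j, v ord0 j != 0.
    apply: contrapT => h; move/eqP: v0; apply; apply/rowP => j; rewrite mxE.
    by apply: contrapT => /eqP vj; apply: h; exists j.
  have := quadf_ge0 (v ord0) pf.
  have -> : quadf S (v ord0) = l * dotf (v ord0) (v ord0).
    rewrite /quadf /dotf mulr_sumr; apply: eq_bigr => k _.
    rewrite mulrCA; congr (_ * _).
    have := congr1 (fun A : 'rV_K => A ord0 k) vS; rewrite !mxE => <-.
    by apply: eq_bigr => m _; rewrite mulrC pf.1.
  by rewrite pmulr_lge0// (dotf_gt0 vj).
pose N := invmx M.
have [b b0 Nb] := quadf_upper_bound N.
have symN : N^T = N by rewrite /N trmx_inv symM.
have key (w : 'I_K -> R) : b^-1 * dotf w w <= quadf M w.
  pose x : 'cV[R]_K := \col_k w k.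
  have xE : (fun k => x k ord0) = w by apply/funext => k; rewrite mxE.
  have dE : (x^T *m x) ord0 ord0 = dotf w w.
    by rewrite mxE; apply: eq_bigr => k _; rewrite !mxE.
  have := M0 (fun k => (x - b^-1 *: (N *m x)) k ord0).
  rewrite -quadf_mx.
  have -> : (x - b^-1 *: (N *m x))^T *m M *m (x - b^-1 *: (N *m x)) =
    x^T *m M *m x - (2 * b^-1) *: (x^T *m x) + (b^-1 ^+ 2) *: (x^T *m N *m x).
    have -> : (x - b^-1 *: (N *m x))^T = x^T - b^-1 *: (x^T *m N).
      by apply/matrixP => k l; rewrite -[in RHS]symN -trmx_mul !mxE.
    have zM : x^T *m N *m M = x^T by rewrite -mulmxA mulVmx// mulmx1.
    have My : M *m (N *m x) = x by rewrite mulmxA mulmxV// mul1mx.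
    rewrite mulmxBl -scalemxAl zM mulmxBl !mulmxBr -!scalemxAl -!scalemxAr.
    rewrite -[x^T *m M *m (N *m x)]mulmxA My [x^T *m (N *m x)]mulmxA.
    by apply/matrixP => k l; rewrite !mxE; ring.
  rewrite mxE [X in X + _]mxE [X in _ + X]mxE [X in _ + X + _]mxE [X in _ - X + _]mxE.
  rewrite dE !quadf_mx xE => h.
  have := Nb w; have binv : 0 < b^-1 by rewrite invr_gt0.
  rewrite -(ler_pM2l (exprn_gt0 2 binv)) mulrA.
  have -> : b^-1 ^+ 2 * b = b^-1 by field; rewrite gt_eqF.
  by move=> h2; lra.
have : L + b^-1 <= L.
  apply: lb_le_inf => // _ [w [j wj] <-].
  rewrite ler_pdivlMr ?(dotf_gt0 wj)// mulrDl -lerBrDl -quadM; exact: key.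
by rewrite gerDl leNgt invr_gt0 b0.
Qed.

End rayleigh.

(** * Bounded Lipschitz distance of normal laws *)

Section dBL.
Context {R : realType}.
Local Notation leb := (@lebesgue_measure R).
Local Notation gam := (@normal_prob R 0 1).

Definition gauss_law (mu : probability (measurableTypeR R) R) (m s : R) :=
  forall B : set (measurableTypeR R), measurable B -> mu B = gam (affine m s @^-1` B).

Lemma centered_normal_law (v : R) : 0 <= v ->
  gauss_law (centered_normal v) 0 (Num.sqrt v).
Proof.
move=> v0 B mB; rewrite /centered_normal; have [->|vn0] := eqVneq v 0.
  rewrite sqrtr0 /= diracE.
  have [B0|B0] := boolP (0 \in B).
    rewrite (_ : _ @^-1` _ = setT) ?probability_setT//.
    by apply/seteqP; split=> // x _; rewrite /= /affine mul0r addr0; exact: set_mem.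
  rewrite (_ : _ @^-1` _ = set0) ?measure0//.
  apply/seteqP; split=> // x; rewrite /= /affine mul0r addr0 => /mem_set.
  by rewrite (negbTE B0).
have s0 : Num.sqrt v != 0 by rewrite gt_eqF// sqrtr_gt0 lt_neqAle eq_sym vn0.
have mind : measurable_fun setT (fun x : measurableTypeR R => (\1_B x)%:E : \bar R).
  exact/measurable_EFinP.
have ind0 (x : measurableTypeR R) : (0 <= (\1_B x)%:E :> \bar R)%E by rewrite lee_fin.
have := std_normal_affine_density 0 s0 mind ind0.
rewrite -[X in _ -> X = _]/(\int[leb]_(x in B) (normal_pdf 0 (Num.sqrt v) x)%:E)%E.
set A := _ @^-1` B; rewrite -[A]setIT.
rewrite -(integral_indic gam measurableT); last first.
  by rewrite /A -[X in measurable X]setTI; exact: measurable_affine.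
move=> h; transitivity (\int[leb]_x ((\1_B x)%:E * (normal_pdf 0 (Num.sqrt v) x)%:E))%E.
  rewrite integral_mkcond; apply: eq_integral => x _.
  by rewrite patchE indicE; case: ifP => _; rewrite ?mul1e ?mul0e.
by rewrite -h; apply: eq_integral => z _; rewrite !indicE.
Qed.

Lemma std_normal_setT : (gam setT = 1)%E.
Proof. exact: probability_setT. Qed.

Lemma std_normal_lty : (gam setT < +oo)%E.
Proof. by rewrite std_normal_setT ltry. Qed.

Lemma integral_gauss_law mu m s (h : R -> R) : gauss_law mu m s ->
  measurable_fun setT h -> (forall x, `|h x| <= 1) ->
  \int[mu]_x h x = \int[gam]_z h (m + s * z).
Proof.
move=> muE mh h1; congr fine.
have mphi := measurable_affine m s.
rewrite [LHS](eq_measure_integral (pushforward gam (affine m s))); last first.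
  by move=> A mA _; exact: muE.
rewrite integral_pushforward//.
  exact/measurable_EFinP.
apply: (measurable_bounded_integrable (f := h \o affine m s)) => //.
- by rewrite preimage_setT.
- by rewrite preimage_setT; exact: std_normal_lty.
- by rewrite preimage_setT; apply: measurableT_comp.
- by exists 1; split; rewrite ?num_real// => y y1 x _ /=; rewrite (le_trans (h1 _))// ltW.
Qed.

(** [x^2 <= 4 exp (x^2 / 4)] bounds the integrand by a multiple of the normal density
    of variance 2. *)
Lemma std_normal_second_moment : exists2 V : R, 0 <= V & (\int[gam]_z (z ^+ 2)%:E <= V%:E)%E.
Proof.
pose k := 4 * (normal_peak 1 / normal_peak (Num.sqrt 2)) : R.
have s0 : Num.sqrt 2 != 0 :> R by rewrite gt_eqF// sqrtr_gt0.
have k0 : 0 <= k by rewrite mulr_ge0// divr_ge0// normal_peak_ge0.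
exists k => //.
rewrite ge0_integral_normal_prob; last 2 first.
- by apply/measurable_EFinP; apply: measurable_funX.
- by move=> x; rewrite lee_fin sqr_ge0.
apply: (@le_trans _ _ (\int[leb]_x (k%:E * (normal_pdf 0 (Num.sqrt 2) x)%:E))%E).
  apply: ge0_le_integral => //.
  - by move=> x _; rewrite mule_ge0// lee_fin ?sqr_ge0 ?normal_pdf_ge0.
  - apply: emeasurable_funM; apply/measurable_EFinP; first exact: measurable_funX.
    exact: measurable_normal_pdf.
  - apply: emeasurable_funM => //; apply/measurable_EFinP; exact: measurable_normal_pdf.
  move=> x _; rewrite -!EFinM lee_fin !normal_pdfE ?oner_neq0//.
  rewrite /normal_fun /k mulrCA.
  have p2 : normal_peak (Num.sqrt 2) != 0 :> R by rewrite gt_eqF// normal_peak_gt0.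
  rewrite [leRHS](_ : _ = normal_peak 1 *
    (4 * expR (- (x - 0) ^+ 2 / (Num.sqrt 2 ^+ 2 *+ 2)))); last by field.
  apply: ler_wpM2l; first exact: normal_peak_ge0.
  rewrite sqr_sqrtr// expr1n subr0.
  have -> : expR (- x ^+ 2 / (1 *+ 2)) = expR (- (x ^+ 2 / 4)) * expR (- x ^+ 2 / (2 *+ 2)) :> R.
    by rewrite -expRD; congr expR; field.
  rewrite mulrA; apply: ler_wpM2r; first exact: expR_ge0.
  rewrite expRN ler_pdivrMr ?expR_gt0//.
  by have := expR_ge1Dx (x ^+ 2 / 4) => h; lra.
rewrite ge0_integralZl//.
- by rewrite integral_normal_pdf mule1.
- apply/measurable_EFinP; exact: measurable_normal_pdf.
- by move=> x _; rewrite lee_fin normal_pdf_ge0.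
Qed.

Lemma std_normal_abs_integrable : gam.-integrable setT (fun z => `|z|%:E).
Proof.
have [V V0 HV] := std_normal_second_moment.
have mabs : measurable_fun setT (fun z : measurableTypeR R => `|z|%:E).
  apply/measurable_EFinP; exact: normr_measurable.
apply/integrableP; split; first exact: mabs.
apply: (@le_lt_trans _ _ (\int[gam]_z (1 + (z ^+ 2)%:E))%E).
  apply: ge0_le_integral => //.
  - exact: measurableT_comp.
  - by apply: emeasurable_funD => //; apply/measurable_EFinP; apply: measurable_funX.
  move=> x _; rewrite /= normr_id -EFinD lee_fin.
  by rewrite -[x ^+ 2]real_normK ?num_real//; have := sqr_ge0 (`|x| - 1); nra.
rewrite ge0_integralD//.
- rewrite (std_normal_integral_cst 1); apply: (@le_lt_trans _ _ (1 + V%:E)%E); last exact: ltry.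
  exact: leeD2l.
- by move=> x _; rewrite lee_fin sqr_ge0.
- by apply/measurable_EFinP; apply: measurable_funX.
Qed.

Definition BL1 : set (R -> R) :=
  [set h : R -> R | (forall x, `|h x| <= 1) /\ (forall x y, `|h x - h y| <= `|x - y|)].

Lemma BL1_measurable h : BL1 h -> measurable_fun setT h.
Proof.
move=> [_ hL]; apply: continuous_measurable_fun => x.
apply/(@cvgrPdist_le _ R^o) => e e0; near=> t.
apply: (le_trans (hL _ _)); near: t.
by apply: (@cvgr_dist_le _ R^o) => //; exact: cvg_id.
Unshelve. all: by end_near. Qed.

Lemma BL1_integrable h m s : BL1 h -> gam.-integrable setT (EFin \o (fun z => h (m + s * z))).
Proof.
move=> Bh; apply: measurable_bounded_integrable => //.
- exact: std_normal_lty.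
- exact: (measurableT_comp (BL1_measurable Bh) (measurable_affine m s)).
- exists 1; split; rewrite ?num_real// => y y1 x _ /=.
  by rewrite (le_trans (Bh.1 _))// ltW.
Qed.

Definition std_normal_abs_mean : R := \int[gam]_z `|z|.

(** Both laws are images of the same standard normal variable. *)
Lemma BL1_dist h m s m' s' : BL1 h ->
  `|\int[gam]_z h (m + s * z) - \int[gam]_z h (m' + s' * z)| <=
  `|m - m'| + `|s - s'| * std_normal_abs_mean.
Proof.
move=> Bh; rewrite -RintegralB//; last 2 first.
- exact: BL1_integrable.
- exact: BL1_integrable.
apply: le_trans.
  apply: le_normr_Rintegral => //.
  have := integrableB measurableT (BL1_integrable m s Bh) (BL1_integrable m' s' Bh).
  by apply: eq_integrable => // x _; rewrite /= EFinB.
have icst : gam.-integrable setT (EFin \o (fun=> `|m - m'|)).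
  exact: finite_measure_integrable_cst.
have iabs : gam.-integrable setT (EFin \o (fun z => `|s - s'| * `|z|)).
  have := integrableZl measurableT `|s - s'| std_normal_abs_integrable.
  by apply: eq_integrable => // x _; rewrite /= EFinM.
apply: (@le_trans _ _ (\int[gam]_z (`|m - m'| + `|s - s'| * `|z|))).
  apply: le_Rintegral => //.
  - apply: integrable_norm.
    have := integrableB measurableT (BL1_integrable m s Bh) (BL1_integrable m' s' Bh).
    by apply: eq_integrable => // x _; rewrite /= EFinB.
  - have := integrableD measurableT icst iabs.
    by apply: eq_integrable => // x _; rewrite /= EFinD.
  move=> z _; apply: (le_trans (Bh.2 _ _)).
  rewrite (_ : _ - _ = (m - m') + (s - s') * z); last by ring.
  by rewrite -normrM ler_normD.
rewrite RintegralD// Rintegral_cst//.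
rewrite [X in _ * X + _](_ : _ = 1) ?mulr1 ?lerD2l; last by rewrite -[RHS]/(fine 1%E) -std_normal_setT.
by rewrite RintegralZl//; exact: std_normal_abs_integrable.
Qed.

(** The bounded Lipschitz distance as a function of means and standard deviations,
    which makes sense of its regularity in the mean. *)
Definition gauss_dist (m s m' s' : R) : R :=
  sup [set `|\int[gam]_z h (m + s * z) - \int[gam]_z h (m' + s' * z)| | h in BL1].

Lemma dBL_gauss mu nu m s m' s' : gauss_law mu m s -> gauss_law nu m' s' ->
  dBL mu nu = gauss_dist m s m' s'.
Proof.
move=> muE nuE; congr sup; apply/seteqP; split => _ [h Bh <-]; exists h => //.
  by rewrite (integral_gauss_law muE) ?(integral_gauss_law nuE)//; (exact: BL1_measurable || exact: Bh.1).
by rewrite (integral_gauss_law muE) ?(integral_gauss_law nuE)//; (exact: BL1_measurable || exact: Bh.1).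
Qed.

Let BL1_0 : BL1 (cst 0).
Proof. by split=> [x|x y] /=; rewrite ?subrr normr0. Qed.

Lemma gauss_dist_le m s m' s' :
  gauss_dist m s m' s' <= `|m - m'| + `|s - s'| * std_normal_abs_mean.
Proof.
apply: ge_sup; first by eexists; exists (cst 0).
by move=> _ [h Bh <-]; exact: BL1_dist.
Qed.

Lemma gauss_dist_lipschitz m m1 s m' s' :
  gauss_dist m s m' s' <= gauss_dist m1 s m' s' + `|m - m1|.
Proof.
apply: ge_sup; first by eexists; exists (cst 0).
move=> _ [h Bh <-]; set I := \int[gam]_z _; set J := \int[gam]_z _.
pose I1 := \int[gam]_z h (m1 + s * z).
rewrite (_ : I - J = (I1 - J) + (I - I1)); last by ring.
apply: (le_trans (ler_normD _ _)); apply: lerD.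
  apply: ub_le_sup; last by exists h.
  exists (`|m1 - m'| + `|s - s'| * std_normal_abs_mean) => _ [g Bg <-]; exact: BL1_dist.
by have := BL1_dist m s m1 s Bh; rewrite subrr normr0 mul0r addr0.
Qed.

(** Makes the events of the main theorem measurable: the data enter only through the
    mean of the posterior law. *)
Lemma measurable_gauss_dist s m' s' :
  measurable_fun setT (fun m => gauss_dist m s m' s').
Proof.
apply: continuous_measurable_fun => x.
apply/(@cvgrPdist_le _ R^o) => e e0; near=> t.
apply: (@le_trans _ _ `|x - t|).
  have := gauss_dist_lipschitz x t s m' s'; have := gauss_dist_lipschitz t x s m' s'.
  rewrite distrC => h1 h2; rewrite ler_norml; apply/andP; split; lra.
near: t; by apply: (@cvgr_dist_le _ R^o) => //; exact: cvg_id.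
Unshelve. all: by end_near. Qed.

End dBL.

(** * Mean and variance of the posterior error *)

Section blocks.
Context {R : realType} (n K : nat).
Variables (Om : 'I_K -> interval R) (S : 'M[R]_K) (c c1 : R).
Hypothesis n0 : (0 < n)%N.
Hypothesis pS : posdefmx S.
Hypothesis c0 : 0 < c.
Hypothesis c10 : 0 < c1.
Hypothesis Sc : forall u : 'I_K -> R, c * dotf u u <= quadf S u.
Hypothesis one_block : forall i : 'I_n, exists k, forall l, in_block Om i l = (l == k)%:R.

Definition block_size (k : 'I_K) : R := \sum_(i < n) in_block Om i k.
Hypothesis block_size_ge : forall k, c1 * n%:R / K%:R <= block_size k.

Let nR0 : 0 < n%:R :> R. Proof. by rewrite ltr0n. Qed.

Let KR0 (k : 'I_K) : 0 < K%:R :> R.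
Proof. by rewrite ltr0n (leq_ltn_trans _ (ltn_ord k)). Qed.

Lemma block_size_gt0 k : 0 < block_size k.
Proof.
apply: (lt_le_trans _ (block_size_ge k)); rewrite divr_gt0// ?mulr_gt0//.
exact: (KR0 k).
Qed.

(** Every design point lies in exactly one block. *)
Lemma sum_blocks (F : 'I_n -> 'I_K -> R) (g : 'I_n -> R) :
  (forall i k, in_block Om i k != 0 -> F i k = g i) ->
  \sum_(k < K) \sum_(i < n) in_block Om i k * F i k = \sum_(i < n) g i.
Proof.
move=> Fg; rewrite exchange_big; apply: eq_bigr => i _ /=.
have [k hk] := one_block i.
rewrite (bigD1 k)//= big1 => [|l lk]; last by rewrite hk (negbTE lk) mul0r.
by rewrite hk eqxx mul1r addr0 Fg// hk eqxx oner_neq0.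
Qed.

Definition bmean (g : 'I_n -> R) (k : 'I_K) : R :=
  (\sum_(i < n) in_block Om i k * g i) / block_size k.

Lemma block_size_bmean g k : block_size k * bmean g k = \sum_(i < n) in_block Om i k * g i.
Proof. by rewrite /bmean mulrC divfK// gt_eqF// block_size_gt0. Qed.

Lemma block_meanE (g : R -> R) k :
  block_mean n (Om k) g = bmean (fun i => g (design i)) k.
Proof.
rewrite /block_mean /bmean; congr (_ / _).
  rewrite big_mkcond; apply: eq_bigr => i _; rewrite /in_block.
  by case: ifP => _; rewrite ?mul1r ?mul0r.
rewrite /block_size -sum1_card natr_sum big_mkcond; apply: eq_bigr => i _.
by rewrite /in_block inE; case: ifP.
Qed.

Lemma bmean_dist g (delta : R) k i : (forall i j, in_block Om i k != 0 -> in_block Om j k != 0 ->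
   `|g i - g j| <= delta) -> in_block Om i k != 0 -> `|g i - bmean g k| <= delta.
Proof.
move=> gd hi; have N0 := block_size_gt0 k.
rewrite -(ler_pM2l N0) -{1}(gtr0_norm N0) -normrM mulrBr block_size_bmean.
rewrite /block_size mulr_suml -sumrB mulr_suml.
apply: (le_trans (ler_norm_sum _ _ _)); apply: ler_sum => j _.
rewrite -mulrBr normrM.
have [->|hj] := eqVneq (in_block Om j k) 0; first by rewrite normr0 !mul0r.
rewrite ger0_norm ?ler0n//; apply: ler_wpM2l; first exact: ler0n.
exact: gd.
Qed.

Lemma bmean_le g (A : R) k : (forall i, `|g i| <= A) -> `|bmean g k| <= A.
Proof.
move=> gA; have N0 := block_size_gt0 k.
rewrite /bmean normrM normfV (gtr0_norm N0) ler_pdivrMr// mulrC.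
rewrite /block_size mulr_suml; apply: (le_trans (ler_norm_sum _ _ _)).
apply: ler_sum => i _; rewrite normrM ger0_norm ?ler0n//.
by apply: ler_wpM2l => //; exact: ler0n.
Qed.

(** The decomposition of variance within a block. *)
Lemma bmean_sqr g k :
  \sum_(i < n) in_block Om i k * (g i - bmean g k) ^+ 2 =
  \sum_(i < n) in_block Om i k * g i ^+ 2 - block_size k * bmean g k ^+ 2.
Proof.
transitivity (\sum_(i < n) in_block Om i k * g i ^+ 2
   - 2 * bmean g k * (\sum_(i < n) in_block Om i k * g i) + block_size k * bmean g k ^+ 2).
  rewrite mulr_sumr /block_size mulr_suml -sumrB -big_split/=.
  by apply: eq_bigr => i _; ring.
by rewrite -(block_size_bmean g k); ring.
Qed.

(** Jensen's inequality in each block, where averaging has weights at most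
    [K / (c1 n)]. *)
Lemma sum_bmean_sqr g : dotf (bmean g) (bmean g) <=
  K%:R / (c1 * n%:R) * \sum_(i < n) g i ^+ 2.
Proof.
have -> : \sum_(i < n) g i ^+ 2 = \sum_(k < K) \sum_(i < n) in_block Om i k * g i ^+ 2.
  by rewrite (@sum_blocks (fun i _ => g i ^+ 2) (fun i => g i ^+ 2)).
rewrite mulr_sumr; apply: ler_sum => k _; rewrite -expr2.
have N0 := block_size_gt0 k.
have K0 := KR0 k.
have h : block_size k * bmean g k ^+ 2 <= \sum_(i < n) in_block Om i k * g i ^+ 2.
  rewrite -subr_ge0 -bmean_sqr; apply: sumr_ge0 => i _.
  by rewrite mulr_ge0 ?ler0n ?sqr_ge0.
apply: (@le_trans _ _ (K%:R / (c1 * n%:R) * (block_size k * bmean g k ^+ 2))).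
  rewrite mulrA ler_peMl ?sqr_ge0// mulrAC ler_pdivlMr ?mulr_gt0// mul1r.
  by rewrite [leRHS]mulrC -ler_pdivrMr.
by apply: ler_wpM2l => //; rewrite divr_ge0// ?ltW// mulr_gt0.
Qed.

(** [Sigma + N^-1] is positive definite, [N] being the diagonal matrix of the block
    sizes. The solution measures how much the prior shrinks the posterior mean. *)
Lemma shrinkage_exists (v : 'I_K -> R) :
  exists z : 'I_K -> R, forall k, dotf (S k) z + z k / block_size k = v k.
Proof.
pose A : 'M[R]_K := \matrix_(i, j) (S i j + (i == j)%:R / block_size i).
have AE (u : 'I_K -> R) k : dotf (A k) u = dotf (S k) u + u k / block_size k.
  rewrite /dotf (eq_bigr (fun j => S k j * u j + (k == j)%:R * (u k / block_size k))); last first.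
    move=> j _; rewrite mxE; case: eqVneq => [->|_]; rewrite ?mul0r ?addr0// /=; ring.
  rewrite big_split/=; congr (_ + _); rewrite (bigD1 k)//= eqxx mul1r big1 ?addr0//.
  by move=> j; rewrite eq_sym => /negbTE ->; rewrite mul0r.
have pA : posdeff A.
  split=> [i j|u [i ui]].
    rewrite !mxE (posdeff_mx pS).1 eq_sym; congr (_ + _).
    by case: eqVneq => [->|_]; rewrite ?mul0r.
  apply: (@lt_le_trans _ _ (quadf S u)).
    by apply: (lt_le_trans _ (Sc u)); rewrite mulr_gt0// (dotf_gt0 ui).
  apply: ler_sum => k _; rewrite AE mulrDr lerDl mulrA -expr2.
  by rewrite divr_ge0 ?sqr_ge0// ltW// block_size_gt0.
have uA : A \in unitmx by rewrite unitmxE unitfE gt_eqF// det_gt0.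
exists (fun k => (invmx A *m \col_k v k) k ord0) => k; rewrite -AE.
have := congr1 (fun B : 'cV_K => B k ord0) (mulKVmx uA (\col_k v k)).
by rewrite [RHS]mxE => <-; rewrite [RHS]mxE.
Qed.

Section sol.
Variables (v z : 'I_K -> R).
Hypothesis zE : forall k, dotf (S k) z + z k / block_size k = v k.

(** [c |z|^2 <= z^T Sigma z <= z^T v], and [z^T v <= (c |z|^2 + |v|^2 / c) / 2]. *)
Lemma shrinkage_bound : [/\ 0 <= dotf z v, dotf z v <= dotf v v / c &
  dotf z z <= dotf v v / c ^+ 2].
Proof.
have h1 : c * dotf z z <= dotf z v.
  apply: (le_trans (Sc z)); apply: ler_sum => k _; rewrite -zE mulrDr lerDl.
  by rewrite mulrA -expr2 divr_ge0 ?sqr_ge0// ltW// block_size_gt0.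
have h2 : dotf z v <= (c * dotf z z + dotf v v / c) / 2.
  rewrite /dotf mulr_sumr [X in _ + X]mulr_suml -big_split mulr_suml.
  apply: ler_sum => k _ /=; rewrite -subr_ge0.
  rewrite (_ : _ - _ = (c * z k - v k) ^+ 2 / (2 * c)); last by field; rewrite gt_eqF.
  by rewrite divr_ge0 ?sqr_ge0// mulr_ge0// ltW.
have z0 := dotf_ge0 z.
split; first by apply: le_trans h1; rewrite mulr_ge0// ltW.
  lra.
have h3 : c * dotf z z <= dotf v v / c by lra.
by rewrite expr2 invfM mulrA ler_pdivlMr// mulrC.
Qed.

End sol.

Section mean_variance.
Variables (a f0 : R -> R) (z : 'I_K -> R).
Let av := bmean (fun i => a (design i)).
Hypothesis zE : forall k, dotf (S k) z + z k / block_size k = av k.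

Definition error_mean (e : 'I_n -> R) : R :=
  - (Num.sqrt n%:R)^-1 * dotf z (bmean (fun i => f0 (design i) + e i)).

Definition error_var : R :=
  n%:R^-1 * (\sum_(k < K) block_size k * av k ^+ 2 - dotf z av).

Let p (k : 'I_K) := (av k - z k / block_size k) / n%:R.

Lemma precisionE k l : precision n Om S k l = (k == l)%:R * block_size k + invmx S k l.
Proof.
congr (_ + _); rewrite /block_size mulr_sumr; apply: eq_bigr => i _.
have [m hm] := one_block i; rewrite !hm; have [->|kl] := eqVneq k l.
  by case: (l == m); rewrite ?mulr1 ?mulr0.
rewrite mul0r; have [<-|_] := eqVneq k m; last by rewrite mul0r.
by rewrite eq_sym (negbTE kl) mulr0.
Qed.

(** Since [Sigma z = av - N^-1 z], applying the inverse of [Sigma] to [p] gives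
    [z / n], which compensates the correction of [N p]. *)
Lemma precision_solution k : dotf (precision n Om S k) p =
  n%:R^-1 * \sum_(i < n) a (design i) * in_block Om i k.
Proof.
under [in RHS]eq_bigr do rewrite mulrC.
rewrite -block_size_bmean -/(av k).
rewrite /dotf (eq_bigr (fun l => (k == l)%:R * (block_size k * p k) + invmx S k l * p l)); last first.
  by move=> l _; rewrite precisionE; case: eqVneq => [->|_] /=; ring.
rewrite big_split/= (bigD1 k)//= eqxx mul1r [X in _ + X + _]big1 ?addr0; last first.
  by move=> j; rewrite eq_sym => /negbTE ->; rewrite mul0r.
have -> : \sum_(l < K) invmx S k l * p l = z k / n%:R.
  have uS : S \in unitmx by rewrite unitmxE unitfE gt_eqF// det_gt0//; exact: posdeff_mx.
  have := congr1 (fun B : 'cV_K => B k ord0) (mulKmx uS (\col_k z k)).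
  rewrite [in X in _ = X]mxE => <-; rewrite mxE mulr_suml; apply: eq_bigr => l _.
  rewrite -mulrA; congr (_ * _); rewrite mxE /p -(zE l) addrK; congr (_ / _).
  by apply: eq_bigr => m _; rewrite mxE.
have N0 := block_size_gt0 k; rewrite /p; field; rewrite !gt_eqF//.
Qed.

(** The centering [psi_hat] is the sum over the blocks of size times mean of [a] times
    mean of the observations, divided by [n]: only the shrinkage term is left. *)
Lemma error_meanE e :
  Num.sqrt n%:R * (dotf p (score Om (fun i => f0 (design i) + e i)) - psi_hat a f0 Om e) =
  error_mean e.
Proof.
set Y := fun i => _.
have sn : Num.sqrt n%:R != 0 :> R by rewrite gt_eqF// sqrtr_gt0.
have snE : n%:R = Num.sqrt n%:R ^+ 2 :> R by rewrite sqr_sqrtr// ltW.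
have sE k : score Om Y k = block_size k * bmean Y k by rewrite block_size_bmean.
have -> : psi_hat a f0 Om e = n%:R^-1 * \sum_(k < K) block_size k * bmean Y k * av k.
  have projE (g : R -> R) i : Defs.projK n Om g (design i) =
      \sum_(k < K) in_block Om i k * bmean (fun i => g (design i)) k.
    by apply: eq_bigr => k _; rewrite block_meanE.
  rewrite /psi_hat /innerL /noise_avg -[X in _ + X]mulrA -mulrDr; congr (_ * _).
  rewrite (eq_bigr (fun k => av k * (block_size k * bmean (fun i => f0 (design i)) k) +
      av k * \sum_(i < n) in_block Om i k * e i)); last first.
    move=> k _; rewrite -mulrDr mulrC; congr (_ * _).
    rewrite !block_size_bmean -big_split; apply: eq_bigr => i _ /=.
    by rewrite /Y mulrDr.
  rewrite big_split/=; congr (_ + _).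
    under eq_bigr do rewrite projE mulr_sumr.
    rewrite exchange_big; apply: eq_bigr => k _ /=.
    rewrite mulrA [av k * _]mulrC block_size_bmean mulr_suml.
    by apply: eq_bigr => i _; ring.
  rewrite mulr_suml.
  transitivity (\sum_(i < n) \sum_(k < K) av k * (in_block Om i k * e i)).
    apply: eq_bigr => i _; rewrite projE.
    rewrite (_ : _ / _ = e i * \sum_(k < K) in_block Om i k * av k).
      by rewrite mulr_sumr; apply: eq_bigr => k _; ring.
    by field.
  by rewrite exchange_big; apply: eq_bigr => k _ /=; rewrite mulr_sumr.
rewrite /error_mean /dotf.
rewrite (eq_bigr (fun k => n%:R^-1 * (block_size k * bmean Y k * av k - z k * bmean Y k))); last first.
  by move=> k _; have N0 := block_size_gt0 k; rewrite sE /p; field; rewrite !gt_eqF.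
rewrite -mulr_sumr -mulrBr sumrB.
rewrite {2}snE; field; exact: sn.
Qed.

Lemma error_varE : error_var = n%:R * quadf (precision n Om S) p.
Proof.
rewrite /error_var /quadf [dotf z av]/dotf -sumrB !mulr_sumr; apply: eq_bigr => k _.
rewrite precision_solution; under eq_bigr do rewrite mulrC.
rewrite -block_size_bmean -/av /p; have N0 := block_size_gt0 k.
by field; rewrite !gt_eqF.
Qed.

Lemma posterior_gauss_law e :
  gauss_law (posterior_error_law a Om S (fun i => f0 (design i) + e i) (psi_hat a f0 Om e))
    (error_mean e) (Num.sqrt error_var).
Proof.
move=> B mB; rewrite -error_meanE error_varE sqrtrM ?ler0n//.
apply: posterior_error_lawE => //; exact: precision_solution.
Qed.

Let avav_le (A : R) : (forall i : 'I_n, `|a (design i)| <= A) ->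
  dotf av av <= K%:R * A ^+ 2.
Proof.
move=> aA; rewrite mulr_natl -[X in _ *+ X]card_ord -sumr_const.
apply: ler_sum => k _; rewrite -expr2 -real_normK ?num_real// ler_pXn2r ?nnegrE//.
  exact: bmean_le.
by rewrite (le_trans _ (bmean_le k aA)).
Qed.

(** [|z^T ybar| <= (|z|^2 + |ybar|^2) / 2], and both squared norms are of order [K]. *)
Lemma error_mean_le (A : R) e : (forall i : 'I_n, `|a (design i)| <= A) ->
  `|error_mean e| <= K%:R / (2 * Num.sqrt n%:R) *
     (A ^+ 2 / c ^+ 2 + (n%:R^-1 * \sum_(i < n) (f0 (design i) + e i) ^+ 2) / c1).
Proof.
move=> aA; pose Y (i : 'I_n) := f0 (design i) + e i.
have [_ _ zz] := shrinkage_bound zE.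
have sn : 0 < Num.sqrt n%:R :> R by rewrite sqrtr_gt0.
have avav := avav_le aA.
have h : `|dotf z (bmean Y)| <= (dotf z z + dotf (bmean Y) (bmean Y)) / 2.
  apply: (le_trans (ler_norm_sum _ _ _)).
  rewrite /dotf -big_split mulr_suml; apply: ler_sum => k _ /=.
  rewrite ler_norml; have := sqr_ge0 (z k - bmean Y k); have := sqr_ge0 (z k + bmean Y k).
  by move=> ? ?; apply/andP; split; nra.
have yy := sum_bmean_sqr Y.
rewrite /error_mean normrM normrN normfV (gtr0_norm sn).
apply: (@le_trans _ _ ((Num.sqrt n%:R)^-1 * ((K%:R * A ^+ 2 / c ^+ 2 +
   K%:R / (c1 * n%:R) * \sum_(i < n) Y i ^+ 2) / 2))).
  apply: ler_wpM2l; first by rewrite invr_ge0 ltW.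
  apply: (le_trans h); rewrite ler_pM2r ?invr_gt0//; apply: lerD => //.
  by apply: (le_trans zz); rewrite ler_pM2r ?invr_gt0 ?exprn_gt0.
rewrite le_eqVlt; apply/orP; left; apply/eqP.
by field; rewrite !gt_eqF.
Qed.

(** The difference is the mean squared distance of [a] to its projection plus the
    shrinkage term [z^T av / n]. *)
Lemma error_var_le (A delta : R) : (forall i : 'I_n, `|a (design i)| <= A) ->
  (forall k (i j : 'I_n), in_block Om i k != 0 -> in_block Om j k != 0 ->
     `|a (design i) - a (design j)| <= delta) ->
  `|sqnormL n a - error_var| <= delta ^+ 2 + K%:R * A ^+ 2 / (c * n%:R) /\
  0 <= error_var.
Proof.
move=> aA ad.
have [za0 za _] := shrinkage_bound zE.
split; last by rewrite error_varE mulr_ge0 ?ler0n// quadf_ge0//; exact: posdeff_precision.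
pose D := \sum_(k < K) \sum_(i < n) in_block Om i k * (a (design i) - av k) ^+ 2.
have D0 : 0 <= D.
  by apply: sumr_ge0 => k _; apply: sumr_ge0 => i _; rewrite mulr_ge0 ?ler0n ?sqr_ge0.
have Dle : D <= n%:R * delta ^+ 2.
  rewrite mulr_natl -[X in _ *+ X]card_ord -sumr_const.
  rewrite -(@sum_blocks (fun _ _ => delta ^+ 2))//; apply: ler_sum => k _; apply: ler_sum => i _.
  have [->|hi] := eqVneq (in_block Om i k) 0; first by rewrite !mul0r.
  apply: ler_wpM2l; first exact: ler0n.
  have h : `|a (design i) - av k| <= delta.
    by apply: (@bmean_dist (fun i => a (design i))) => //; exact: ad.
  rewrite -real_normK ?num_real// ler_pXn2r ?nnegrE//.
  exact: le_trans h.
have -> : sqnormL n a - error_var = n%:R^-1 * (D + dotf z av).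
  rewrite /sqnormL /error_var -mulrBr; congr (_ * _).
  rewrite opprB addrCA addrC; congr (_ + _).
  rewrite -(@sum_blocks (fun i _ => a (design i) ^+ 2))// -sumrB.
  by apply: eq_bigr => k _; rewrite bmean_sqr.
rewrite ger0_norm; last by rewrite mulr_ge0 ?invr_ge0 ?ler0n ?addr_ge0.
rewrite mulrC ler_pdivrMr//.
have -> : (delta ^+ 2 + K%:R * A ^+ 2 / (c * n%:R)) * n%:R = n%:R * delta ^+ 2 + K%:R * A ^+ 2 / c.
  by field; rewrite !gt_eqF.
apply: lerD => //; apply: (le_trans za); rewrite ler_pM2r ?invr_gt0//.
exact: avav_le.
Qed.

End mean_variance.
End blocks.

(** * Number and length of the blocks *)

Section asymptotics.
Context {R : realType}.

(** [ln n <= 2 sqrt n], so that [n / ln n] is at least [sqrt n / 2]. *)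
Lemma nblocks_infty (alpha M : R) : 0 < alpha ->
  \forall n \near \oo, M <= (nblocks alpha n)%:R.
Proof.
move=> al0; pose k := 2 * alpha + 1; have k0 : 0 < k by rewrite /k; lra.
pose M' := `|M| + 1; have M'0 : 0 < M' by rewrite ltr_wpDl.
pose s := 2 * M' `^ k; have s0 : 0 < s by rewrite mulr_gt0// powR_gt0.
near=> n.
have n2 : (1 < n)%N by near: n; exact: nbhs_infty_gt.
have n1 : 1 < n%:R :> R by rewrite ltr1n.
have nR0 : 0 < n%:R :> R by rewrite (lt_trans _ n1).
have ns : s ^+ 2 <= n%:R by near: n; exact: nbhs_infty_ger.
have rn0 : 0 < Num.sqrt n%:R :> R by rewrite sqrtr_gt0.
have rnE : Num.sqrt n%:R ^+ 2 = n%:R :> R by rewrite sqr_sqrtr// ltW.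
have sr : s <= Num.sqrt n%:R.
  by rewrite -(@ler_pXn2r _ 2)// ?nnegrE ?(ltW s0) ?(ltW rn0)// rnE.
have lnn : ln n%:R <= 2 * Num.sqrt n%:R :> R.
  by rewrite -[in leLHS]rnE lnXn// -[_ *+ 2]mulr_natl ler_pM2l// ltW// ln_sublinear.
have ln0 : 0 < ln n%:R :> R by exact: ln_gt0.
have q : M' `^ k <= n%:R / ln n%:R.
  apply: (@le_trans _ _ (Num.sqrt n%:R / 2)); first by rewrite ler_pdivlMr// mulrC.
  rewrite ler_pdivrMr// mulrAC ler_pdivlMr// -[in leRHS]rnE.
  by have := ler_wpM2l (ltW rn0) lnn; lra.
have u : M' <= (n%:R / ln n%:R) `^ k^-1.
  have := ge0_ler_powR (ltW (_ : 0 < k^-1)) _ _ q.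
  rewrite -powRrM divff ?gt_eqF// powRr1 ?(ltW M'0)//; apply.
  - by rewrite invr_gt0.
  - by rewrite nnegrE powR_ge0.
  - by rewrite nnegrE divr_ge0// ltW.
rewrite (le_trans (ler_norm _))// -(lerD2r 1).
apply: (le_trans u); rewrite natr1 ltW//; exact: truncnS_gt.
Unshelve. all: by end_near. Qed.

(** The number of blocks is of order at most [n `^ (2 alpha + 1)^-1], and the exponent
    is less than 1/2; the logarithm is only bounded below, by [ln 2]. *)
Lemma nblocks_sqrt (alpha e : R) : 2^-1 < alpha -> 0 < e ->
  \forall n \near \oo, (nblocks alpha n)%:R <= e * Num.sqrt n%:R.
Proof.
move=> al e0; pose k := 2 * alpha + 1; have k2 : 2 < k by rewrite /k; lra.
have k0 : 0 < k by lra.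
pose h := 2^-1 - k^-1.
have h0 : 0 < h by rewrite subr_gt0 ltf_pV2 ?posrE.
pose l : R := ln 2; have l0 : 0 < l by apply: ln_gt0; rewrite ltr1n.
pose C := (l^-1) `^ k^-1; have C0 : 0 < C by rewrite powR_gt0// invr_gt0.
near=> n.
have n2 : (1 < n)%N by near: n; exact: nbhs_infty_gt.
have n1 : 1 < n%:R :> R by rewrite ltr1n.
have nR0 : 0 < n%:R :> R by rewrite (lt_trans _ n1).
have nC : (C / e) `^ h^-1 <= n%:R by near: n; exact: nbhs_infty_ger.
have ln0 : 0 < ln n%:R :> R by exact: ln_gt0.
have lln : l <= ln n%:R by rewrite ler_ln ?posrE// ler_nat.
apply: (@le_trans _ _ ((n%:R / ln n%:R) `^ k^-1)).
  by rewrite truncn_le powR_ge0.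
apply: (@le_trans _ _ (C * n%:R `^ k^-1)).
  rewrite /C -powRM ?invr_ge0 ?(ltW l0) ?(ltW nR0)//.
  apply: ge0_ler_powR; rewrite ?nnegrE ?invr_ge0 ?(ltW k0)//.
  - by rewrite divr_ge0// ltW.
  - by rewrite mulr_ge0 ?invr_ge0// ltW.
  - by rewrite mulrC ler_pM2r// lef_pV2 ?posrE.
have Ce : C / e <= n%:R `^ h.
  have := ge0_ler_powR (ltW h0) _ _ nC.
  rewrite -powRrM mulVf ?gt_eqF// powRr1 ?divr_ge0 ?(ltW C0) ?(ltW e0)//; apply.
  - by rewrite nnegrE powR_ge0.
  - by rewrite nnegrE ltW.
rewrite -powR12_sqrt ?(ltW nR0)//.
have -> : 2^-1 = h + k^-1 by rewrite /h subrK.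
rewrite powRD; last by apply/implyP => _; rewrite gt_eqF.
rewrite mulrA ler_pM2r ?powR_gt0// mulrC -ler_pdivrMr//.
Unshelve. all: by end_near. Qed.

Lemma holder_bound (s : R) (f : R -> R) : 0 < s -> holder01 s f ->
  exists2 B : R, 0 <= B & forall x, x \in `[0, 1] -> `|f x| <= B.
Proof.
move=> s0 [L HL]; exists (`|f 0| + `|L|) => [|x x01]; first by rewrite addr_ge0.
have h0 : (0 : R) \in `[0, 1] by rewrite in_itv/= lexx ler01.
rewrite -[f x](subrK (f 0)) addrC (le_trans (ler_normD _ _))// lerD2l.
apply: (le_trans (HL _ _ x01 h0)); rewrite subr0.
apply: (@le_trans _ _ (`|L| * `|x| `^ s)).
  by apply: ler_wpM2r; rewrite ?powR_ge0// ler_norm.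
rewrite ler_piMr//.
have := x01; rewrite in_itv/= => /andP[x0 x1].
have := ge0_ler_powR (ltW s0) (_ : `|x| \in Num.nneg) (_ : 1 \in Num.nneg).
rewrite powR1; apply; rewrite ?nnegrE//.
by rewrite ger0_norm.
Qed.

Lemma holder_small (s : R) (f : R -> R) (e : R) : 0 < s -> holder01 s f -> 0 < e ->
  exists2 d : R, 0 < d & forall x y, x \in `[0, 1] -> y \in `[0, 1] ->
    `|x - y| <= d -> `|f x - f y| <= e.
Proof.
move=> s0 [L HL] e0.
pose q := e / (`|L| + 1); have q0 : 0 < q by rewrite divr_gt0// ltr_wpDl.
exists (q `^ s^-1) => [|x y x01 y01 xy]; first exact: powR_gt0.
apply: (le_trans (HL _ _ x01 y01)).
apply: (@le_trans _ _ ((`|L| + 1) * q)); last by rewrite /q mulrCA divff ?mulr1// gt_eqF// ltr_wpDl.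
apply: (@le_trans _ _ ((`|L| + 1) * `|x - y| `^ s)).
  by apply: ler_wpM2r; rewrite ?powR_ge0// (le_trans (ler_norm _))// lerDl.
apply: ler_wpM2l; first by rewrite addr_ge0.
have := ge0_ler_powR (ltW s0) _ _ xy; rewrite -powRrM mulVf ?gt_eqF// powRr1 ?(ltW q0)//.
by apply; rewrite nnegrE// powR_ge0.
Qed.

Lemma interval_length (I : interval R) (d x y : R) :
  (lebesgue_measure [set` I] <= d%:E)%E -> x \in I -> y \in I -> `|x - y| <= d.
Proof.
move=> Id; wlog xy : x y / x <= y => [hw xI yI|].
  by have /orP[|yx] := le_total x y; [move=> ?; exact: hw|rewrite distrC; exact: hw].
move=> xI yI; rewrite distrC ger0_norm ?subr_ge0// -lee_fin.
apply: le_trans Id.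
have -> : (y - x)%:E = lebesgue_measure [set` `[x, y]].
  rewrite lebesgue_measure_itv/= lte_fin.
  by move: xy; rewrite le_eqVlt => /predU1P[->|->]; rewrite ?ltxx ?subrr.
apply: le_measure; rewrite ?inE//.
move=> z /= zxy;
by apply: (interval_is_interval xI yI); move: zxy; rewrite in_itv.
Qed.

Lemma design_in01 n (i : 'I_n) : (design i : R) \in `[0, 1].
Proof.
have n0 : (0 < n)%N by rewrite (leq_ltn_trans _ (ltn_ord i)).
rewrite in_itv/= /design divr_ge0//= ler_pdivrMr ?ltr0n// mul1r ler_nat.
exact: ltn_ord.
Qed.

Lemma one_block_of_partition n K (Om : 'I_K -> interval R) :
  partition [set: 'I_K] (fun k => [set` Om k]) `[0, 1] ->
  forall i : 'I_n, exists k, forall l, in_block Om i l = (l == k)%:R.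
Proof.
move=> [cov tri _] i.
have : cover [set: 'I_K] (fun k => [set` Om k]) (design i).
  by rewrite cov; exact: design_in01.
move=> [k _ ki]; exists k => l; rewrite /in_block; congr (_%:R).
have [->|lk] := eqVneq l k; first by rewrite ki.
rewrite (_ : (design i \in Om l) = false)//.
apply/negbTE/negP => li; move/eqP: lk; apply.
by apply: (tri l k) => //; exists (design i).
Qed.

(** [|s - t|^2 <= |s - t| (s + t)] for nonnegative [s] and [t]. *)
Lemma sqrt_dist (x y d : R) : 0 <= x -> 0 <= y -> 0 <= d -> `|x - y| <= d ^+ 2 ->
  `|Num.sqrt x - Num.sqrt y| <= d.
Proof.
move=> x0 y0 d0; rewrite -[in X in X -> _](sqr_sqrtr x0) -[in X in X -> _](sqr_sqrtr y0).
have := sqrtr_ge0 x; have := sqrtr_ge0 y.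
move: (Num.sqrt x) (Num.sqrt y) => s t t0 s0 h.
rewrite -(@ler_pXn2r _ 2)// ?nnegrE//; apply: le_trans h.
rewrite subr_sqr normrM expr2; apply: ler_wpM2l => //.
by rewrite [leRHS]ger0_norm ?addr_ge0// ler_norml; apply/andP; split; lra.
Qed.

End asymptotics.

(** * Convergence in probability *)

Lemma second_moment_of_std_normal d (T : measurableType d) (R : realType)
    (P : probability T R) (X : {RV P >-> R}) (V : R) :
  (\int[normal_prob 0 1]_z (z ^+ 2)%:E <= V%:E)%E ->
  (forall B : set R, measurable B -> distribution P X B = normal_prob 0 1 B) ->
  (\int[P]_w (X w ^+ 2)%:E <= V%:E)%E.
Proof.
move=> HV XE; apply: le_trans HV; rewrite le_eqVlt; apply/orP; left; apply/eqP.
have mX : measurable_fun setT (X : T -> measurableTypeR R) by exact: measurable_funPT X.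
rewrite [RHS](eq_measure_integral (pushforward P (X : T -> measurableTypeR R))); last first.
  by move=> B mB _; exact: (esym (XE B mB)).
rewrite ge0_integral_pushforward//.
- by apply/measurable_EFinP; apply: measurable_funX.
- by move=> z _; rewrite lee_fin sqr_ge0.
Qed.

(** Markov's inequality for a bound of the absolute posterior mean that is affine in
    the squared errors: [r] bounds the distance of the standard deviations, which
    accounts for at most half of [e], so the mean must exceed [e / 2] on the event. *)
Lemma posterior_dBL_bound d (T : measurableType d) (R : realType)
  (P : probability T R) n K (eps : 'I_n -> {RV P >-> R})
  (Om : 'I_K -> interval R) (S : 'M[R]_K) (a f0 : R -> R) (c c1 A F V delta r e : R) :
  (0 < n)%N -> posdefmx S -> 0 < c -> 0 < c1 ->
  (forall u : 'I_K -> R, c * dotf u u <= quadf S u) ->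
  (forall i : 'I_n, exists k, forall l, in_block Om i l = (l == k)%:R) ->
  (forall k, c1 * n%:R / K%:R <= block_size n Om k) ->
  (forall i : 'I_n, `|a (design i)| <= A) ->
  (forall i : 'I_n, `|f0 (design i)| <= F) ->
  (forall k (i j : 'I_n), in_block Om i k != 0 -> in_block Om j k != 0 ->
     `|a (design i) - a (design j)| <= delta) ->
  0 <= V -> (forall i, \int[P]_w (eps i w ^+ 2)%:E <= V%:E)%E ->
  0 <= r -> delta ^+ 2 + K%:R * A ^+ 2 / (c * n%:R) <= r ^+ 2 ->
  0 < e -> r * @std_normal_abs_mean R <= e / 2 ->
  ((e / 2)%:E * P [set w | (e < dBL
     (posterior_error_law a Om S (fun i => f0 (design i) + eps i w)
        (psi_hat a f0 Om (fun i => eps i w)))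
     (centered_normal (sqnormL n a)))%R] <=
  (K%:R / (2 * Num.sqrt n%:R) * (A ^+ 2 / c ^+ 2 + (2 * F ^+ 2 + 2 * V) / c1))%:E)%E.
Proof.
move=> n0 pS c0 c10 Sc one cnt aA fF ad V0 epsV r0 hr e0 re.
have nR0 : 0 < n%:R :> R by rewrite ltr0n.
have [z zE] := shrinkage_exists n0 pS c0 c10 Sc cnt (bmean Om (fun i : 'I_n => a (design i))).
pose m (w : T) := error_mean Om f0 z (fun i => eps i w).
pose s := Num.sqrt (error_var n Om a z).
pose t := Num.sqrt (sqnormL n a).
have t0 : 0 <= sqnormL n a.
  by rewrite mulr_ge0 ?invr_ge0 ?ler0n// sumr_ge0// => i _; exact: sqr_ge0.
have [var_le var_ge0] := error_var_le n0 pS c0 c10 Sc one cnt zE aA ad.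
have st : `|s - t| <= r.
  by apply: sqrt_dist => //; rewrite distrC; exact: le_trans hr.
have mm : measurable_fun setT m.
  apply: measurable_funM => //; apply: measurable_sum => k.
  apply: measurable_funM => //; apply: measurable_funM => //.
  apply: measurable_sum => i; apply: measurable_funM => //.
  exact: measurable_funD.
have dE w : dBL (posterior_error_law a Om S (fun i => f0 (design i) + eps i w)
      (psi_hat a f0 Om (fun i => eps i w))) (centered_normal (sqnormL n a)) =
    gauss_dist (m w) s 0 t.
  apply: dBL_gauss; last exact: centered_normal_law.
  exact: (posterior_gauss_law n0 pS c10 one cnt f0 zE (fun i => eps i w)).
set E := [set w | _].
have EE : E = [set w | e < gauss_dist (m w) s 0 t].
  by apply/seteqP; split => w /= h; [rewrite -dE|rewrite -dE in h]; exact: h.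
have mE : measurable E.
  have -> : E = (fun w => gauss_dist (m w) s 0 t) @^-1` `]e, +oo[%classic.
    by rewrite EE; apply/seteqP; split => w /=; rewrite in_itv/= andbT.
  have := measurableT_comp (measurable_gauss_dist s 0 t) mm.
  move=> /(_ measurableT `]e, +oo[%classic); rewrite setTI; apply.
  exact: measurable_itv.
pose k := K%:R / (2 * Num.sqrt n%:R) : R.
have k0 : 0 <= k by rewrite divr_ge0 ?mulr_ge0 ?ler0n ?sqrtr_ge0.
pose C0 := A ^+ 2 / c ^+ 2 + 2 * F ^+ 2 / c1.
have C00 : 0 <= C0.
  apply: addr_ge0; apply: divr_ge0; rewrite ?sqr_ge0 ?(ltW c10)//.
  by rewrite mulr_ge0// sqr_ge0.
pose k' := k * (2 / (n%:R * c1)).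
have k'0 : 0 <= k' by rewrite mulr_ge0// divr_ge0// mulr_ge0// ltW.
pose q (w : T) : R := k * C0 + \sum_(i < n) k' * eps i w ^+ 2.
have q0 w : 0 <= q w.
  rewrite addr_ge0 ?mulr_ge0// sumr_ge0// => i _.
  by rewrite mulr_ge0 ?sqr_ge0.
have meps i : measurable_fun setT (fun w => eps i w ^+ 2 : R).
  exact: measurable_funX.
have mq : measurable_fun setT q.
  apply: measurable_funD => //; apply: measurable_sum => i.
  exact: measurable_funM.
have mq_le w : `|m w| <= q w.
  have hm := error_mean_le n0 c0 c10 Sc one cnt f0 zE (fun i => eps i w) aA.
  apply: (le_trans hm).
  have -> : q w = k * (C0 + 2 / (n%:R * c1) * \sum_(i < n) eps i w ^+ 2).
    by rewrite mulrDr mulrA mulr_sumr.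
  apply: ler_wpM2l => //.
  rewrite /C0 -addrA lerD2l.
  have h : \sum_(i < n) (f0 (design i) + eps i w) ^+ 2 <=
      n%:R * (2 * F ^+ 2) + 2 * \sum_(i < n) eps i w ^+ 2.
    rewrite mulr_natl -[X in _ *+ X]card_ord -sumr_const mulr_sumr -big_split/=.
    apply: ler_sum => i _.
    have h1 : f0 (design i) ^+ 2 <= F ^+ 2.
      rewrite -real_normK ?num_real// ler_pXn2r ?nnegrE//.
      exact: le_trans (fF i).
    have := sqr_ge0 (f0 (design i) - eps i w : R); nra.
  rewrite ler_pdivrMr//.
  apply: (@le_trans _ _ (n%:R^-1 * (n%:R * (2 * F ^+ 2) + 2 * \sum_(i < n) eps i w ^+ 2))).
    by apply: ler_wpM2l => //; rewrite invr_ge0 ltW.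
  by rewrite le_eqVlt; apply/orP; left; apply/eqP; field; rewrite !gt_eqF.
have Eq w : E w -> e / 2 <= q w.
  rewrite EE /= => ew; apply: le_trans (mq_le w).
  have := gauss_dist_le (m w) s 0 t; rewrite subr0 => h.
  have g0 : 0 <= @std_normal_abs_mean R by apply: Rintegral_ge0.
  have := ler_wpM2r g0 st; lra.
apply: (@le_trans _ _ (\int[P]_(w in E) (q w)%:E)%E).
  rewrite -(integral_cst P mE); apply: ge0_le_integral => //.
  - by move=> w _; rewrite lee_fin divr_ge0// ltW.
  - by apply/measurable_EFinP; exact: measurable_funTS.
apply: (@le_trans _ _ (\int[P]_w (q w)%:E)%E).
  apply: ge0_subset_integral => //; first exact/measurable_EFinP.
  by move=> w _; rewrite lee_fin.
have -> : (\int[P]_w (q w)%:E = (k * C0)%:E + \sum_(i < n) k'%:E * \int[P]_w (eps i w ^+ 2)%:E)%E.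
  under eq_integral do rewrite /q EFinD -sumEFin.
  rewrite ge0_integralD//; last 3 first.
  - by move=> w _; rewrite lee_fin mulr_ge0.
  - by move=> w _; rewrite sume_ge0// => i _; rewrite lee_fin mulr_ge0 ?sqr_ge0.
  - by apply: emeasurable_sum => i; apply/measurable_EFinP; exact: measurable_funM.
  congr (_ + _)%E.
    rewrite integral_cst// [X in (_ * X)%E](_ : _ = 1%E) ?mule1//.
    exact: probability_setT.
  rewrite ge0_integral_sum//; last 2 first.
  - by move=> i; apply/measurable_EFinP; exact: measurable_funM.
  - by move=> i w _; rewrite lee_fin mulr_ge0 ?sqr_ge0.
  apply: eq_bigr => i _; under eq_integral do rewrite EFinM.
  rewrite ge0_integralZl//.
  - exact/measurable_EFinP.
  - by move=> w _; rewrite lee_fin sqr_ge0.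
apply: (@le_trans _ _ ((k * C0)%:E + \sum_(i < n) k'%:E * V%:E)%E).
  by apply: leeD2l; apply: lee_sum => i _; apply: lee_wpmul2l; rewrite ?lee_fin.
under eq_bigr do rewrite -EFinM.
rewrite sumEFin sumr_const card_ord -EFinD lee_fin -[(_ * V) *+ n]mulr_natl le_eqVlt.
apply/orP; left; apply/eqP; rewrite /k' /C0 -/k; field; rewrite !gt_eqF//.
Qed.

Theorem theorem4p1 (R : realType) (alpha gamma : R)
    (halpha : 2^-1 < alpha <= 1) (hgamma : 2^-1 < gamma <= 1)
    (f0 a : R -> R) (hf0 : holder01 alpha f0) (ha : holder01 gamma a)
    (C_a : R) (hCa : supnorm01 a < C_a)
    (d : nat -> measure_display) (T : forall n, measurableType (d n))
    (P : forall n, probability (T n) R)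
    (eps : forall n, 'I_n -> {RV (P n) >-> R})
    (heps : forall n, iid_std_normal (eps n))
    (Om : forall n, 'I_(nblocks alpha n) -> interval R)
    (hOm : equivalent_blocks Om)
    (Sigma : forall n, 'M[R]_(nblocks alpha n))
    (hSigma : forall n, posdefmx (Sigma n))
    (c : R) (hc : 0 < c)
    (hmin : forall n, (1 < n)%N -> c < lambda_min (Sigma n))
    (C : R) (hmax : forall n, (1 < n)%N -> lambda_max (Sigma n) <= C * n%:R) :
  let Y (n : nat) (w : T n) (i : 'I_n) : R := f0 (design i) + eps n i w in
  let PsiHat (n : nat) (w : T n) : R := psi_hat a f0 (Om n) (fun i => eps n i w) in
  let law (n : nat) (w : T n) :=
    posterior_error_law a (Om n) (Sigma n) (Y n w) (PsiHat n w) in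
  forall e : R, 0 < e ->
    (fun n => P n [set w | e < dBL (law n w) (centered_normal (sqnormL n a))])
      @ \oo --> 0%E.
Proof.
move=> Y PsiHat law e e0.
case/andP: halpha => al _; case/andP: hgamma => ga _.
have al0 : 0 < alpha by lra.
have ga0 : 0 < gamma by lra.
have [A A0 aA] := holder_bound ga0 ha.
have [F F0 fF] := holder_bound al0 hf0.
have [V V0 HV] := @std_normal_second_moment R.
have [c1 [c2 [c10 blocks]]] := hOm.
have g0 : 0 <= @std_normal_abs_mean R by apply: Rintegral_ge0.
(* [r] is the accuracy required of the standard deviation; adding 1 to the absolute
   moment avoids a division by zero. The oscillation of [a] on a block is allotted
   [r / 2], and [ee] is the ratio of [K] to [sqrt n] below which shrinkage costs at
   most [r ^+ 2 / 2]. *)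
pose r := e / (2 * (@std_normal_abs_mean R + 1)).
have r0 : 0 < r by rewrite divr_gt0// mulr_gt0// ltr_wpDl.
have rg : r * @std_normal_abs_mean R <= e / 2.
  rewrite /r mulrAC ler_pdivrMr ?mulr_gt0 ?ltr_wpDl//.
  by rewrite (_ : e / 2 * _ = e * (std_normal_abs_mean + 1)); [rewrite ler_pM2l// lerDl|field].
have [dl dl0 adl] := holder_small ga0 ha (divr_gt0 r0 (ltr0Sn R 1)).
pose M := A ^+ 2 / c ^+ 2 + (2 * F ^+ 2 + 2 * V) / c1.
pose ee := r ^+ 2 * c / (2 * (A ^+ 2 + 1)).
have A1 : 0 < A ^+ 2 + 1 by rewrite ltr_wpDl// sqr_ge0.
have ee0 : 0 < ee by rewrite divr_gt0 ?(mulr_gt0 _ hc) ?(exprn_gt0 2 r0)// mulr_gt0.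
apply: (@squeeze_cvge _ _ _ _ (fun=> 0%E) _
    (fun n => ((nblocks alpha n)%:R / Num.sqrt n%:R * (M / e))%:E)); last 2 first.
- exact: cvg_cst.
- apply/fine_cvgP; split; first by near=> n.
  rewrite [X in _ --> X](_ : _ = 0 * (M / e)); last by rewrite mul0r.
  apply: cvgMl.
  apply/cvgrPdist_le => x x0; near=> n.
  rewrite /= sub0r normrN ger0_norm ?divr_ge0 ?sqrtr_ge0//.
  rewrite ler_pdivrMr ?sqrtr_gt0 ?ltr0n; last by near: n; exact: nbhs_infty_gt.
  by near: n; exact: nblocks_sqrt.
near=> n; rewrite measure_ge0/=.
have n1 : (1 < n)%N by near: n; exact: nbhs_infty_gt.
have n0 : (0 < n)%N by exact: ltnW.
have nR0 : 0 < n%:R :> R by rewrite ltr0n.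
have [part blk] := blocks n n1.
have K1 : 1 <= (nblocks alpha n)%:R :> R by near: n; exact: nblocks_infty.
have K0 : 0 < (nblocks alpha n)%:R :> R by exact: lt_le_trans K1.
have Kd : c2 / dl <= (nblocks alpha n)%:R :> R by near: n; exact: nblocks_infty.
have Ke : (nblocks alpha n)%:R <= ee * Num.sqrt n%:R by near: n; exact: nblocks_sqrt.
have := @posterior_dBL_bound _ _ R (P n) n _ (eps n) (Om n) (Sigma n) a f0
  c c1 A F V (r / 2) r e n0 (hSigma n) hc c10.
move=> /(_ (lambda_min_rayleigh (hSigma n) (hmin n n1)) (one_block_of_partition part)).
move=> H; have {}H := H _ _ _ _ V0 _ (ltW r0) _ e0 rg.
have : ((e / 2)%:E * P n [set w | (e < dBL (law n w) (centered_normal (sqnormL n a)))%R] <=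
    ((nblocks alpha n)%:R / (2 * Num.sqrt n%:R) * M)%:E)%E.
  apply: H.
  - move=> k; have [/andP[+ _] _] := blk k.
    by rewrite /block_mass [leRHS]mulrC ler_pdivlMr// mulrAC.
  - by move=> i; apply: aA; exact: design_in01.
  - by move=> i; apply: fF; exact: design_in01.
  - move=> k i j hi hj; apply: adl; [exact: design_in01|exact: design_in01|].
    apply: (@le_trans _ _ (c2 / (nblocks alpha n)%:R)).
      apply: (interval_length (I := Om n k)).
      + by have [_ /andP[]] := blk k.
      + by move: hi; rewrite /in_block; case: (_ \in _); rewrite ?eqxx.
      + by move: hj; rewrite /in_block; case: (_ \in _); rewrite ?eqxx.
    by rewrite ler_pdivrMr// mulrC -ler_pdivrMr.
  - by move=> i; apply: second_moment_of_std_normal => //; exact: (heps n).2.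
  - have sn : Num.sqrt n%:R <= n%:R :> R.
      rewrite -[leRHS]sqr_sqrtr ?ler0n// expr2 ler_peMl ?sqrtr_ge0//.
      by rewrite -[leLHS]sqrtr1 ler_sqrt ?ltr01// ler1n.
    have h : (nblocks alpha n)%:R * A ^+ 2 / (c * n%:R) <= r ^+ 2 / 2.
      rewrite ler_pdivrMr ?mulr_gt0//.
      apply: (@le_trans _ _ (ee * n%:R * (A ^+ 2 + 1))).
        apply: ler_pM; rewrite ?ler0n ?sqr_ge0// ?lerDl//.
        by apply: (le_trans Ke); rewrite ler_pM2l.
      by rewrite le_eqVlt; apply/orP; left; apply/eqP; rewrite /ee; field; rewrite gt_eqF.
    apply: (le_trans (lerD (lexx _) h)); rewrite (_ : (r / 2) ^+ 2 = r ^+ 2 / 4); last by field.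
    by have := sqr_ge0 r; lra.
rewrite -lee_pdivlMl ?divr_gt0// => /le_trans; apply.
rewrite -EFinM lee_fin le_eqVlt; apply/orP; left; apply/eqP.
by field; rewrite !gt_eqF ?sqrtr_gt0.
Unshelve. all: by end_near. Qed.
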